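(* Let $\alpha,\beta\in\mathbb{C}$ with $|\alpha|=|\beta|=1$, where $\beta=e^{2\pi\mathbf{i}\theta}$ with $\theta$ irrational. For $\rho>0$ let $\mathbb{S}^1_\rho=\{y\in\mathbb{C}: |y|=\rho\}$ and define $A^{\alpha,\rho}\colon\mathbb{S}^1_\rho\to \mathrm{M}(2;\mathbb{C})$ by $A^{\alpha,\rho}(y)=\begin{pmatrix}\alpha & y\\ 1 & 1\end{pmatrix}$. Then the Lyapunov exponent of the cocycle $(A^{\alpha,\rho},\beta)$ is \begin{itemize} \item positive as soon as $\rho>1$; \item zero as soon as $\rho\le 1$. \end{itemize} More precisely, the birational map $f_{\alpha,\beta}(x,y)=\left(\frac{\alpha x+y}{x+1},\beta y\right)$ of $\mathbb{P}^1_\mathbb{C}\times\mathbb{P}^1_\mathbb{C}$ is semi-conjugate, via $(x,y)\mapsto(x,y^2)$, to $g(x,y)=\left(\frac{\alpha x+y^2}{x+1},\beta^{1/2}y\right)$ (i.e. $f_{\alpha,\beta}\circ(x,y^2)=(x,y^2)\circ g$), and the Lyapunov exponent of the cocycle $(B^{\alpha,\rho},\beta^{1/2})$, where $B^{\alpha,\rho}(y)=\begin{pmatrix}\alpha & y^2\\ 1& 1\end{pmatrix}$ for $y\in\mathbb{S}^1_\rho$, is equal to $\max(0,\ln\rho)$.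
   Context: Here $\beta^{1/2}$ denotes a fixed square root of $\beta$. For a continuous (analytic) map $C\colon\mathbb{S}^1_\rho\to\mathrm{M}(2;\mathbb{C})$ and $\gamma\in\mathbb{C}$ with $|\gamma|=1$, the cocycle $(C,\gamma)$ is the skew product $(v,y)\mapsto (C(y)v,\gamma y)$ on $\mathbb{C}^2\times\mathbb{S}^1_\rho$; its iterates are $C_n(y)=C(\gamma^{n-1}y)\cdots C(\gamma y)C(y)$, and its Lyapunov exponent is $L(C,\gamma)=\lim_{n\to+\infty}\frac1n\int_{\mathbb{S}^1_\rho}\ln\|C_n(y)\|\,\mathrm{d}y$, where $\mathrm{d}y$ is the normalized Lebesgue (Haar) measure on $\mathbb{S}^1_\rho$. The map $f_{\alpha,\beta}$ is the affine expression of the birational map $(x:y:z)\dashrightarrow((\alpha x+y)z:\beta y(x+z):z(x+z))$ of $\mathbb{P}^2_\mathbb{C}$; its iterates $f^n_{\alpha,\beta}(x,y)$ act on the first coordinate by the Möbius transformation associated with the matrix product of the $A^{\alpha,\rho}(\beta^k y)$. *)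

(* Defs.v *)
From Stdlib Require Import Reals.
From Coquelicot Require Import Coquelicot.
Open Scope R_scope.

Definition irrational (t : R) : Prop :=
  forall p q : Z, q <> 0%Z -> t <> IZR p / IZR q.

Definition cis (t : R) : C := (cos t, sin t).

Record mat2 := Mat2 { m11 : C; m12 : C; m21 : C; m22 : C }.

Definition mat2_id : mat2 := Mat2 1%C 0%C 0%C 1%C.

Definition mat2_mul (M N : mat2) : mat2 :=
  Mat2 (m11 M * m11 N + m12 M * m21 N)%C (m11 M * m12 N + m12 M * m22 N)%C
       (m21 M * m11 N + m22 M * m21 N)%C (m21 M * m12 N + m22 M * m22 N)%C.

Definition opnorm (M : mat2) : R :=
  real (Lub_Rbar (fun r => exists v1 v2 : C,
     Cmod v1 ^ 2 + Cmod v2 ^ 2 = 1 /\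
     r = sqrt (Cmod (m11 M * v1 + m12 M * v2)%C ^ 2 +
               Cmod (m21 M * v1 + m22 M * v2)%C ^ 2))).

Fixpoint cocycle_iter (Cc : C -> mat2) (g : C) (n : nat) (y : C) : mat2 :=
  match n with
  | O => mat2_id
  | S k => mat2_mul (Cc (Cpow g k * y)%C) (cocycle_iter Cc g k y)
  end.

(* (1/n) \int_{S^1_rho} ln ||C_n(y)|| dy, with normalized Haar measure on the
   circle of radius rho, parametrized by y = rho e^{2 pi i t}, t in [0,1]. *)
Definition lyap_term (Cc : C -> mat2) (g : C) (rho : R) (n : nat) : R :=
  / INR n * RInt (fun t => ln (opnorm (cocycle_iter Cc g n
                                (RtoC rho * cis (2 * PI * t))%C))) 0 1.

Definition lyapunov_is (Cc : C -> mat2) (g : C) (rho L : R) : Prop :=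
  is_lim_seq (lyap_term Cc g rho) (Finite L).

Definition matA (alpha : C) (y : C) : mat2 := Mat2 alpha y 1%C 1%C.
Definition matB (alpha : C) (y : C) : mat2 := Mat2 alpha (y * y)%C 1%C 1%C.

(* affine expressions of the birational maps, on the chart x + 1 <> 0 *)
Definition f_ab (alpha beta : C) (p : C * C) : C * C :=
  (((alpha * fst p + snd p) / (fst p + 1))%C, (beta * snd p)%C).
Definition g_map (alpha gam : C) (p : C * C) : C * C :=
  (((alpha * fst p + snd p * snd p) / (fst p + 1))%C, (gam * snd p)%C).
Definition semi (p : C * C) : C * C := (fst p, (snd p * snd p)%C).

(* Main.v *)
(** The entries of the [n]-th iterate satisfy the [q]-difference recursion
    [x_(n+2) = (1 + alpha) x_(n+1) - (alpha - beta^n y) x_n].  Expanding in powers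
    of [y], the coefficients are, up to unimodular factors, complete homogeneous
    symmetric functions of the numbers [beta^j] and [alpha beta^j], [j <= k <= n/2].
    Their power sums are bounded both by [2 k + 2] and, independently of [k], by
    [4 / |1 - beta^l|], so Newton's identities show that these functions grow
    subexponentially, for every irrational [theta] and with no Diophantine condition.
    Hence [||A_n(y)|| <= M e^(eta n) max(1, |y|)^(n/2)] for every [eta > 0].

    Conversely [||A_n||^2 >= |det A_n| = prod_(i < n) |alpha - beta^i y|], and
    [1/n] times the mean of the logarithm of the right-hand side is [max(0, ln rho)].
    To avoid integrating a logarithm with singularities when [rho = 1], the continuous
    function [f = ln ||A_n||] is averaged over dyadic translates: this preserves its
    integral, flattens it, and squares the coefficients of the factors
    [a_i - b_i e^(2 pi i s)] of the minorant.

    Thus [(A, beta)] has exponent [max(0, ln rho) / 2], and [(B, beta^(1/2))] on the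
    circle of radius [rho] has the same exponent as [(A, beta)] on that of radius
    [rho^2]. *)

Require Import Defs.
From Stdlib Require Import Reals.
From Coquelicot Require Import Coquelicot.
From Stdlib Require Import Lra Lia List Factorial Wf_nat.
Open Scope R_scope.

(** * Finite sums of complex and real sequences *)

Fixpoint csum (f : nat -> C) (n : nat) : C :=
  match n with O => 0%C | S m => (csum f m + f m)%C end.

Fixpoint rsum (f : nat -> R) (n : nat) : R :=
  match n with O => 0 | S m => rsum f m + f m end.

Lemma csum_ext (f g : nat -> C) (n : nat) :
  (forall j, (j < n)%nat -> f j = g j) -> csum f n = csum g n.
Proof.
  induction n as [|n IH]; intros H; [reflexivity|]; simpl.
  rewrite IH by (intros; apply H; lia). rewrite H by lia. reflexivity.
Qed.

Lemma csum_plus (f g : nat -> C) (n : nat) :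
  csum (fun j => f j + g j)%C n = (csum f n + csum g n)%C.
Proof. induction n as [|n IH]; simpl; [|rewrite IH]; ring. Qed.

Lemma csum_scal (c : C) (f : nat -> C) (n : nat) :
  csum (fun j => c * f j)%C n = (c * csum f n)%C.
Proof. induction n as [|n IH]; simpl; [|rewrite IH]; ring. Qed.

Lemma csum_shift (f : nat -> C) (n : nat) :
  csum f (S n) = (f 0%nat + csum (fun j => f (S j)) n)%C.
Proof.
  induction n as [|n IH]; [simpl; ring|].
  change (csum f (S (S n))) with (csum f (S n) + f (S n))%C.
  rewrite IH. simpl. ring.
Qed.

Lemma csum_even_odd (f : nat -> C) (n : nat) :
  csum f (2 * n) =
  (csum (fun k => f (2 * k)%nat) n + csum (fun k => f (S (2 * k))) n)%C.
Proof.
  induction n as [|n IH]; [simpl; ring|].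
  replace (2 * S n)%nat with (S (S (2 * n))) by lia.
  change (csum f (S (S (2 * n))))
    with (csum f (2 * n) + f (2 * n)%nat + f (S (2 * n)))%C.
  rewrite IH. cbn [csum]. ring.
Qed.

Lemma csum_Cmod (f : nat -> C) (g : nat -> R) (n : nat) :
  (forall j, (j < n)%nat -> Cmod (f j) <= g j) -> Cmod (csum f n) <= rsum g n.
Proof.
  induction n as [|n IH]; intros H; simpl.
  - rewrite Cmod_0. lra.
  - eapply Rle_trans; [apply Cmod_triangle|].
    apply Rplus_le_compat; [apply IH; intros; apply H|apply H]; lia.
Qed.

Lemma rsum_le (f g : nat -> R) (n : nat) :
  (forall j, (j < n)%nat -> f j <= g j) -> rsum f n <= rsum g n.
Proof.
  induction n as [|n IH]; intros H; simpl; [lra|].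
  apply Rplus_le_compat; [apply IH; intros; apply H|apply H]; lia.
Qed.

Lemma rsum_scal (c : R) (f : nat -> R) (n : nat) :
  rsum (fun j => c * f j) n = c * rsum f n.
Proof. induction n as [|n IH]; simpl; [|rewrite IH]; ring. Qed.

Lemma rsum_const (c : R) (n : nat) : rsum (fun _ => c) n = INR n * c.
Proof. induction n as [|n IH]; [simpl; ring|]. rewrite S_INR. simpl. rewrite IH. ring. Qed.

(** * Complete homogeneous symmetric functions *)

(** Coefficients of the series [prod 1 / (1 - x s)] over [x] in [l]. The inner [fix] is needed
    because one recursive call shortens the list and the other lowers the degree. *)
Fixpoint hsym (l : list C) : nat -> C :=
  match l with
  | nil => fun m => match m with O => 1%C | S _ => 0%C end
  | x :: l' => fix g (m : nat) : C :=
      match m with O => 1%C | S m' => (hsym l' (S m') + x * g m')%C end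
  end.

Lemma hsym_0 (l : list C) : hsym l 0 = 1%C.
Proof. destruct l; reflexivity. Qed.

Lemma hsym_cons (x : C) (l : list C) (m : nat) :
  hsym (x :: l) (S m) = (hsym l (S m) + x * hsym (x :: l) m)%C.
Proof. reflexivity. Qed.

Lemma hsym_map_mult (c : C) (l : list C) (m : nat) :
  hsym (map (Cmult c) l) m = (c ^ m * hsym l m)%C.
Proof.
  revert m. induction l as [|x l IH]; intros m.
  - destruct m; simpl; ring.
  - induction m as [|m IHm]; [simpl; ring|].
    change (map (Cmult c) (x :: l)) with ((c * x)%C :: map (Cmult c) l) in *.
    rewrite !hsym_cons, IH, IHm. rewrite Cpow_S. ring.
Qed.

(** * Power sums and Newton's identities *)

Fixpoint powsum (l : list C) (j : nat) : C :=
  match l with nil => 0%C | x :: l' => (x ^ j + powsum l' j)%C end.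

Definition conv (f g : nat -> C) (m : nat) : C :=
  csum (fun j => f j * g (m - j)%nat)%C (S m).

(** The hypotheses say [g = h / (1 - x s)] as power series; multiplying by the series of [f]
    preserves this relation. *)
Lemma conv_step (f g h : nat -> C) (x : C) (m : nat) :
  g 0%nat = h 0%nat -> (forall m, g (S m) = h (S m) + x * g m)%C ->
  conv f g (S m) = (conv f h (S m) + x * conv f g m)%C.
Proof.
  intros H0 HS. unfold conv.
  set (F := fun j : nat => (f j * g (S m - j)%nat)%C).
  set (G := fun j : nat => (f j * h (S m - j)%nat)%C).
  change (csum F (S (S m))) with (csum F (S m) + F (S m))%C.
  change (csum G (S (S m))) with (csum G (S m) + G (S m))%C.
  rewrite <- csum_scal.
  replace (F (S m)) with (G (S m)).
  2:{ unfold F, G. rewrite Nat.sub_diag, H0. reflexivity. }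
  replace (csum F (S m))
    with (csum (fun j => G j + x * (f j * g (m - j)%nat)) (S m))%C.
  - rewrite csum_plus. ring.
  - apply csum_ext. intros j Hj. unfold F, G.
    replace (S m - j)%nat with (S (m - j)) by lia. rewrite HS. ring.
Qed.

Lemma conv_geometric (x : C) (l : list C) (m : nat) :
  conv (fun j => x ^ j)%C (hsym l) m = hsym (x :: l) m.
Proof.
  induction m as [|m IH].
  - unfold conv. simpl. rewrite hsym_0. ring.
  - rewrite hsym_cons, <- IH. unfold conv. rewrite csum_shift, <- csum_scal.
    f_equal; [rewrite Nat.sub_0_r; simpl; ring|].
    apply csum_ext. intros j Hj. simpl. ring.
Qed.

(** This is [H' = P H], where [P] is the logarithmic derivative of [H = prod 1 / (1 - x s)]. Adding
    [x] to the list adds [x / (1 - x s)] to [P] and divides [H] by [1 - x s]. *)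
Lemma newton_identity (l : list C) (m : nat) :
  (RtoC (INR (S m)) * hsym l (S m))%C = conv (fun j => powsum l (S j)) (hsym l) m.
Proof.
  revert m. induction l as [|x l IH]; intros m.
  - unfold conv. rewrite (csum_ext _ (fun _ => 0 * 0)%C) by (intros; simpl; ring).
    rewrite csum_scal. simpl. ring.
  - assert (D : forall g m, conv (fun j => powsum (x :: l) (S j)) g m =
        (x * conv (fun j => x ^ j)%C g m + conv (fun j => powsum l (S j)) g m)%C).
    { intros g k. unfold conv. rewrite <- csum_scal, <- csum_plus.
      apply csum_ext. intros. simpl. ring. }
    induction m as [|m IHm].
    + rewrite D. specialize (IH 0%nat). unfold conv in *. simpl in *.
      rewrite hsym_0 in IH.
      replace (hsym l 1) with (powsum l 1).
      * simpl. ring.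
      * rewrite Cmult_1_l in IH. rewrite IH. simpl. ring.
    + rewrite (conv_step _ _ (hsym l) x), <- IHm, D, conv_geometric, <- IH.
      * rewrite (hsym_cons x l (S m)). rewrite (S_INR (S m)), RtoC_plus. ring.
      * rewrite !hsym_0. reflexivity.
      * intros k. apply hsym_cons.
Qed.

(* The weights [w j = |p_(j+1)| / rho^(j+1)] majorize the logarithmic derivative
   of the generating series, hence [e^T] majorizes the series at [1/rho]. *)
Lemma newton_growth (p h : nat -> C) (w : nat -> R) (rho T : R) :
  0 < rho -> h 0%nat = 1%C ->
  (forall m, (RtoC (INR (S m)) * h (S m))%C = conv p h m) ->
  (forall j, Cmod (p j) <= w j * rho ^ S j) ->
  (forall n, rsum w n <= T) ->
  forall m, Cmod (h m) <= exp T * rho ^ m.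
Proof.
  intros Hrho H0 HN Hp HT.
  assert (w0 : forall j, 0 <= w j).
  { intros j. apply Rmult_le_reg_r with (rho ^ S j); [apply pow_lt; lra|].
    rewrite Rmult_0_l. eapply Rle_trans; [apply Cmod_ge_0|apply Hp]. }
  assert (T0 : 0 <= T) by (apply (HT 0%nat)).
  (* The induction carries the partial sum [E m] of the exponential series. With the constant
     [exp T] in its place, the step would need [T <= m + 1], which fails for small [m]. *)
  set (E := fun m => sum_f_R0 (fun k => T ^ k / INR (fact k)) m).
  assert (t0 : forall k, 0 <= T ^ k / INR (fact k)).
  { intros k. apply Rmult_le_pos; [apply pow_le; lra|].
    left. apply Rinv_0_lt_compat, INR_fact_lt_0. }
  assert (Emono : forall i j, (i <= j)%nat -> E i <= E j).
  { intros i j Hij. induction Hij as [|j Hij IH]; [lra|].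
    unfold E in *. simpl. specialize (t0 (S j)). simpl in t0. lra. }
  (* Termwise, [T * T^k / k!] equals [(k + 1) * T^(k+1) / (k+1)!], and [k + 1 <= m + 1]. *)
  assert (Estep : forall m, T * E m <= INR (S m) * E (S m)).
  { induction m as [|m IH].
    - unfold E. simpl. lra.
    - unfold E in *.
      rewrite (tech5 _ m), (tech5 _ (S m)).
      assert (Q : T * (T ^ S m / INR (fact (S m)))
                = INR (S (S m)) * (T ^ S (S m) / INR (fact (S (S m))))).
      { rewrite (fact_simpl (S m)), mult_INR. simpl pow. field. split.
        - apply INR_fact_neq_0.
        - apply not_0_INR. lia. }
      rewrite !Rmult_plus_distr_l, Q.
      apply Rplus_le_compat_r.
      eapply Rle_trans; [apply IH|].
      apply Rmult_le_compat_r.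
      { apply cond_pos_sum. exact t0. }
      apply le_INR. lia. }
  assert (Main : forall m, Cmod (h m) <= E m * rho ^ m).
  { intros m. induction m as [m IH] using lt_wf_ind.
    destruct m as [|m].
    - rewrite H0, Cmod_1. unfold E. simpl. lra.
    - assert (Hm : 0 < INR (S m)) by (apply lt_0_INR; lia).
      apply Rmult_le_reg_l with (INR (S m)); [exact Hm|].
      replace (INR (S m) * Cmod (h (S m)))
        with (Cmod (RtoC (INR (S m)) * h (S m))%C).
      2:{ rewrite Cmod_mult, Cmod_R, Rabs_pos_eq by lra. reflexivity. }
      rewrite HN. unfold conv.
      apply Rle_trans with (rsum (fun j => (E m * rho ^ S m) * w j) (S m)).
      + apply csum_Cmod. intros j Hj. rewrite Cmod_mult.
        apply Rle_trans with ((w j * rho ^ S j) * (E m * rho ^ (m - j))).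
        * apply Rmult_le_compat; try apply Cmod_ge_0; [apply Hp|].
          eapply Rle_trans; [apply IH; lia|].
          apply Rmult_le_compat_r; [apply pow_le; lra|apply Emono; lia].
        * right. replace (rho ^ S m) with (rho ^ S j * rho ^ (m - j)).
          -- ring.
          -- rewrite <- pow_add. f_equal. lia.
      + rewrite rsum_scal.
        apply Rle_trans with ((E m * rho ^ S m) * T).
        * apply Rmult_le_compat_l; [|apply HT].
          apply Rmult_le_pos; [apply cond_pos_sum; exact t0|apply pow_le; lra].
        * replace (E m * rho ^ S m * T) with ((T * E m) * rho ^ S m) by ring.
          rewrite <- Rmult_assoc. apply Rmult_le_compat_r; [apply pow_le; lra|apply Estep]. }
  intros m. eapply Rle_trans; [apply Main|].
  apply Rmult_le_compat_r; [apply pow_le; lra|]. apply exp_ge_taylor, T0.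
Qed.

(** * Subexponential growth of the solutions of the recursion *)

(** The numbers [b^j z] and [a b^j z] for [j < k], arranged so that removing the first pair leaves a
    shorter list of the same shape, rescaled by [b]. *)
Fixpoint qlist (a b z : C) (k : nat) : list C :=
  match k with O => nil | S k' => z :: (a * z)%C :: qlist a b (b * z)%C k' end.

Lemma qlist_map (a b c z : C) (k : nat) :
  qlist a b (c * z)%C k = map (Cmult c) (qlist a b z k).
Proof.
  revert z. induction k as [|k IH]; intros z; [reflexivity|]. simpl.
  f_equal. f_equal; [ring|]. rewrite <- IH. f_equal. ring.
Qed.

(** A geometric sum of ratio [b^j], with the denominator cleared so that [b^j = 1] needs no separate
    treatment. *)
Lemma powsum_qlist (a b z : C) (k j : nat) :
  ((1 - b ^ j) * powsum (qlist a b z k) j = (1 + a ^ j) * z ^ j * (1 - (b ^ k) ^ j))%C.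
Proof.
  revert z. induction k as [|k IH]; intros z; simpl.
  - rewrite Cpow_1_l. ring.
  - rewrite !Cmult_plus_distr_l, IH, !Cpow_mult_l. ring.
Qed.

Lemma Cmod_pow_unit (z : C) (j : nat) : Cmod z = 1 -> Cmod (z ^ j)%C = 1.
Proof. intros H. rewrite Cmod_pow, H. apply pow1. Qed.

Lemma Cmod_minus_triangle (x y : C) : Cmod (x - y) <= Cmod x + Cmod y.
Proof. unfold Cminus. eapply Rle_trans; [apply Cmod_triangle|]. rewrite Cmod_opp. lra. Qed.

Lemma powsum_qlist_le (a b z : C) (k j : nat) :
  Cmod a = 1 -> Cmod b = 1 -> Cmod z = 1 ->
  Cmod (powsum (qlist a b z k) j) <= 2 * INR k.
Proof.
  intros Ha Hb. revert z. induction k as [|k IH]; intros z Hz.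
  - simpl. rewrite Cmod_0. lra.
  - cbn [qlist powsum]. rewrite S_INR.
    eapply Rle_trans; [apply Cmod_triangle|].
    rewrite Cmod_pow_unit by assumption.
    eapply Rle_trans; [apply Rplus_le_compat_l, Cmod_triangle|].
    rewrite Cmod_pow_unit by (rewrite Cmod_mult, Ha, Hz; ring).
    assert (Hbz : Cmod (b * z)%C = 1) by (rewrite Cmod_mult, Hb, Hz; ring).
    specialize (IH _ Hbz). lra.
Qed.

Lemma powsum_qlist_bounded (a b : C) (k j : nat) :
  Cmod a = 1 -> Cmod b = 1 -> (b ^ j)%C <> 1%C ->
  Cmod (powsum (qlist a b 1 k) j) <= 4 / Cmod (1 - b ^ j)%C.
Proof.
  intros Ha Hb Hj.
  assert (D : 0 < Cmod (1 - b ^ j)%C).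
  { apply Cmod_gt_0. intros E. apply Hj.
    replace (b ^ j)%C with (1 - (1 - b ^ j))%C by ring. rewrite E. ring. }
  apply Rmult_le_reg_l with (Cmod (1 - b ^ j)%C); [exact D|].
  rewrite <- Cmod_mult, powsum_qlist, !Cmod_mult.
  rewrite (Cmod_pow_unit 1 j) by apply Cmod_1.
  replace (Cmod (1 - b ^ j)%C * (4 / Cmod (1 - b ^ j)%C)) with (2 * 1 * 2) by (field; lra).
  assert (Cmod (1 + a ^ j)%C <= 2).
  { eapply Rle_trans; [apply Cmod_triangle|]. rewrite Cmod_1, Cmod_pow_unit; auto; lra. }
  assert (Cmod (1 - (b ^ k) ^ j)%C <= 2).
  { eapply Rle_trans; [apply Cmod_minus_triangle|].
    rewrite Cmod_1, Cmod_pow_unit; [lra|]. apply Cmod_pow_unit, Hb. }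
  apply Rmult_le_compat; try apply Cmod_ge_0; try lra.
  rewrite Rmult_1_r. apply Cmod_ge_0.
Qed.

(** The first [K] weights come from the bound on power sums that is uniform in the length of the
    list, the later ones from the trivial bound, damped by a geometric factor. *)
Lemma rsum_split_geometric (d : nat -> R) (c x : R) (K n : nat) :
  (forall j, 0 <= d j) -> 0 <= c -> 0 < x < 1 ->
  rsum (fun j => if (j <? K)%nat then d j else c * x ^ S j) n
  <= rsum d K + c * x ^ K / (1 - x).
Proof.
  intros Hd Hc Hx.
  assert (Hge : forall m, 0 <= c * x ^ m / (1 - x)).
  { intros m. apply Rmult_le_pos; [apply Rmult_le_pos; [lra|apply pow_le; lra]|].
    left; apply Rinv_0_lt_compat; lra. }
  destruct (Nat.le_gt_cases n K) as [Hn|Hn].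
  - apply Rle_trans with (rsum d K); [|specialize (Hge K); lra].
    apply Rle_trans with (rsum d n).
    + apply rsum_le. intros j Hj. destruct (Nat.ltb_spec j K); [lra|lia].
    + clear Hge. induction Hn as [|m Hn IH]; [lra|]. simpl. specialize (Hd m). lra.
  (* Subtracting the remaining tail gives a bound that can be carried through the induction on
     [n]. *)
  - apply Rle_trans with (rsum d K + (c * x ^ K / (1 - x) - c * x ^ n / (1 - x)));
      [|specialize (Hge n); lra].
    induction Hn as [|m Hn IH].
    + cbn [rsum]. rewrite (proj2 (Nat.ltb_ge K K)) by lia.
      apply Rplus_le_compat.
      * apply rsum_le. intros j Hj. destruct (Nat.ltb_spec j K); [lra|lia].
      * apply Rle_trans with (c * x ^ K); [|right; simpl; field; lra].
        simpl. assert (0 <= c * x ^ K) by (apply Rmult_le_pos; [lra|apply pow_le; lra]).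
        nra.
    + cbn [rsum]. rewrite (proj2 (Nat.ltb_ge m K)) by lia.
      eapply Rle_trans; [apply Rplus_le_compat_r, IH|].
      assert (0 <= c * x ^ m) by (apply Rmult_le_pos; [lra|apply pow_le; lra]).
      assert (Q : c * x ^ m / (1 - x) - c * x ^ S m / (1 - x) = c * x ^ m)
        by (simpl; field; lra).
      assert (c * x ^ S m <= c * x ^ m) by (simpl; nra). lra.
Qed.

Lemma exp_mult_nat (x : R) (n : nat) : exp (x * INR n) = exp x ^ n.
Proof.
  induction n as [|n IH]; [simpl; rewrite Rmult_0_r; apply exp_0|].
  rewrite S_INR, Rmult_plus_distr_l, Rmult_1_r, exp_plus, IH. simpl. ring.
Qed.

Lemma hsym_qlist_subexponential (a b : C) (eta : R) :
  Cmod a = 1 -> Cmod b = 1 -> (forall j, (b ^ S j)%C <> 1%C) -> 0 < eta ->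
  exists M, 0 < M /\ forall k m,
    Cmod (hsym (qlist a b 1 k) m) <= M * exp eta ^ k * exp eta ^ m.
Proof.
  intros Ha Hb Hirr Heta.
  set (rho := exp eta).
  assert (Hrho : 1 < rho) by (rewrite <- exp_0; apply exp_increasing; lra).
  set (x := / rho).
  assert (Hx : 0 < x < 1).
  { unfold x. split; [apply Rinv_0_lt_compat; lra|].
    rewrite <- Rinv_1. apply Rinv_lt_contravar; lra. }
  set (d := fun j => 4 / Cmod (1 - b ^ S j)%C).
  assert (Hd : forall j, 0 <= d j).
  (* For [k = 0] the list is empty, and the uniform bound says that [d j] dominates a modulus. *)
  { intros j. unfold d. eapply Rle_trans; [apply Cmod_ge_0|].
    apply (powsum_qlist_bounded a b 0 (S j)); auto. }
  (* With [x^K < eta (1 - x) / 2], the geometric tail [2 k x^K / (1 - x)] is at most [eta k]. The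
     first [K] weights contribute only a constant, independent of [k]. *)
  destruct (pow_lt_1_zero x) with (y := eta * (1 - x) / 2) as [K HK].
  { rewrite Rabs_pos_eq; lra. }
  { apply Rmult_lt_0_compat; [apply Rmult_lt_0_compat|]; lra. }
  specialize (HK K (Nat.le_refl K)).
  rewrite Rabs_pos_eq in HK by (apply pow_le; lra).
  exists (exp (rsum d K)). split; [apply exp_pos|]. intros k m.
  replace (rho ^ k) with (exp (eta * INR k)) by apply exp_mult_nat.
  rewrite <- exp_plus.
  apply newton_growth with (p := fun j => powsum (qlist a b 1 k) (S j))
    (w := fun j => if (j <? K)%nat then d j else (2 * INR k) * x ^ S j).
  - lra.
  - apply hsym_0.
  - apply newton_identity.
  - intros j. assert (1 <= rho ^ S j) by (apply pow_R1_Rle; lra).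
    destruct (Nat.ltb_spec j K).
    + apply Rle_trans with (d j * 1); [|apply Rmult_le_compat_l; auto].
      rewrite Rmult_1_r. apply powsum_qlist_bounded; auto.
    + unfold x. rewrite pow_inv, Rmult_assoc, Rinv_l by lra. rewrite Rmult_1_r.
      apply powsum_qlist_le; auto. apply Cmod_1.
  - intros n. pose proof (pos_INR k).
    eapply Rle_trans; [apply rsum_split_geometric; auto; lra|].
    apply Rplus_le_compat_l.
    apply Rle_trans with (2 * INR k * (eta * (1 - x) / 2) / (1 - x)).
    + apply Rmult_le_compat_r; [left; apply Rinv_0_lt_compat; lra|].
      apply Rmult_le_compat_l; lra.
    + right. field. lra.
Qed.

(** * Expansion of the recursion in powers of [y] *)

Fixpoint dshift (k : nat) (u : nat -> C) (n : nat) : C :=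
  match k, n with
  | O, _ => u n
  | S k', S (S m) => dshift k' u m
  | S _, _ => 0%C
  end.

(* [u = v / ((1 - s) (1 - a s))] as power series in [s]. *)
Definition filtered (a : C) (u v : nat -> C) : Prop :=
  u 0%nat = v 0%nat /\ u 1%nat = (v 1%nat + (1 + a) * u 0%nat)%C /\
  forall m, u (S (S m)) = (v (S (S m)) + (1 + a) * u (S m) - a * u m)%C.

(** On power series [dshift k] is multiplication by [s^(2k)], which commutes with division by
    [(1 - s) (1 - a s)]. *)
Lemma filtered_dshift (a : C) (u v : nat -> C) (k : nat) :
  filtered a u v -> filtered a (dshift k u) (dshift k v).
Proof.
  intros H. induction k as [|k [H0 [H1 HS]]]; [exact H|].
  split; [reflexivity|]. split; [simpl; ring|].
  intros [|[|m]]; cbn [dshift].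
  - rewrite H0. ring.
  - rewrite H1. ring.
  - apply HS.
Qed.

Lemma dshift_twist (b : C) (v : nat -> C) (k n : nat) :
  (b ^ (2 * k) * dshift k (fun m => b ^ m * v m) n = b ^ n * dshift k v n)%C.
Proof.
  revert n. induction k as [|k IH]; intros n; [simpl; ring|].
  destruct n as [|[|n]]; cbn [dshift]; [ring|ring|].
  replace (2 * S k)%nat with (2 + 2 * k)%nat by lia.
  rewrite Cpow_add_r, <- Cmult_assoc, IH. simpl. ring.
Qed.

(** The shifted coefficient vanishes unless [2 k <= n], and then [r^k <= Y^(2k) <= Y^n]. *)
Lemma dshift_bound (u : nat -> C) (r B rho Y : R) (k n : nat) :
  1 <= rho -> 1 <= Y -> 0 <= r <= Y ^ 2 -> 0 <= B ->
  (forall m, Cmod (u m) <= B * rho ^ m) ->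
  r ^ k * Cmod (dshift k u n) <= B * rho ^ n * Y ^ n.
Proof.
  intros Hrho HY Hr HB Hu. revert n. induction k as [|k IH]; intros n.
  - simpl. rewrite Rmult_1_l, <- (Rmult_1_r (Cmod _)).
    apply Rmult_le_compat; [apply Cmod_ge_0|lra|apply Hu|apply pow_R1_Rle; lra].
  - assert (Hp : forall m, 0 <= B * rho ^ m * Y ^ m).
    { intros m. apply Rmult_le_pos; [apply Rmult_le_pos|]; auto; apply pow_le; lra. }
    destruct n as [|[|n]]; cbn [dshift].
    + rewrite Cmod_0, Rmult_0_r. apply Hp.
    + rewrite Cmod_0, Rmult_0_r. apply Hp.
    + cbn [pow]. rewrite Rmult_assoc.
      apply Rle_trans with (Y ^ 2 * (B * rho ^ n * Y ^ n)).
      * apply Rmult_le_compat; [lra| |lra|apply IH].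
        apply Rmult_le_pos; [apply pow_le; lra|apply Cmod_ge_0].
      * specialize (Hp n).
        replace (B * (rho * (rho * rho ^ n)) * (Y * (Y * Y ^ n)))
          with ((rho * rho) * (Y ^ 2 * (B * rho ^ n * Y ^ n))) by ring.
        assert (0 <= Y ^ 2) by (apply pow_le; lra).
        assert (0 <= Y ^ 2 * (B * rho ^ n * Y ^ n)) by (apply Rmult_le_pos; auto).
        rewrite <- (Rmult_1_l (Y ^ 2 * _)) at 1.
        apply Rmult_le_compat_r; [assumption|nra].
Qed.

(** The list with one more pair is [1], [a], followed by the old list multiplied by [b]. The scaling
    multiplies the degree [m] function by [b^m]; the two new entries divide the series by
    [(1 - s) (1 - a s)]. *)
Lemma hsym_qlist_filtered (a b : C) (k : nat) :
  filtered a (hsym (qlist a b 1 (S k))) (fun m => b ^ m * hsym (qlist a b 1 k) m)%C.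
Proof.
  assert (E : forall m, (b ^ m * hsym (qlist a b 1 k) m)%C = hsym (qlist a b (b * 1) k) m).
  { intros m. rewrite qlist_map, hsym_map_mult. reflexivity. }
  cbn [qlist]. set (L := qlist a b (b * 1)%C k) in *.
  split; [|split].
  - rewrite E, !hsym_0. reflexivity.
  - rewrite E, !hsym_cons, !hsym_0. ring.
  - intros m. rewrite E.
    rewrite (hsym_cons 1 _ (S m)), (hsym_cons (a * 1) L (S m)).
    replace (hsym ((a * 1)%C :: L) (S m))
      with (hsym (RtoC 1 :: (a * 1)%C :: L) (S m) - hsym (RtoC 1 :: (a * 1)%C :: L) m)%C.
    + ring.
    + rewrite (hsym_cons 1 _ m). ring.
Qed.

(** The unimodular factor [b^(k (k - 1))]. *)
Fixpoint qphase (b : C) (k : nat) : C :=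
  match k with O => 1%C | S k' => (b ^ (2 * k') * qphase b k')%C end.

Lemma Cmod_qphase (b : C) (k : nat) : Cmod b = 1 -> Cmod (qphase b k) = 1.
Proof.
  intros Hb. induction k as [|k IH]; [apply Cmod_1|]. cbn [qphase].
  rewrite Cmod_mult, IH, Cmod_pow_unit by assumption. ring.
Qed.

Definition fundamental (a b y : C) (x : nat -> C) : Prop :=
  x 0%nat = 1%C /\ x 1%nat = (1 + a)%C /\
  forall n, x (S (S n)) = ((1 + a) * x (S n) - (a - b ^ n * y) * x n)%C.

(** The part of degree [k] in [y] of [x n]: the coefficient of [s^n] in [b^(k(k-1)) y^k s^(2k) /
    prod_(j <= k) (1 - b^j s)(1 - a b^j s)]. *)
Definition qterm (a b y : C) (n k : nat) : C :=
  (qphase b k * y ^ k * dshift k (hsym (qlist a b 1 (S k))) n)%C.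

Lemma qterm_0_step (a b y : C) (n : nat) :
  qterm a b y (S (S n)) 0 =
  ((1 + a) * qterm a b y (S n) 0 - a * qterm a b y n 0)%C.
Proof.
  unfold qterm. cbn [dshift].
  destruct (hsym_qlist_filtered a b 0) as [_ [_ HS]]. rewrite HS. simpl hsym at 1. ring.
Qed.

Lemma qterm_S_step (a b y : C) (n k : nat) :
  qterm a b y (S (S n)) (S k) =
  ((1 + a) * qterm a b y (S n) (S k) - a * qterm a b y n (S k)
   + b ^ n * y * qterm a b y n k)%C.
Proof.
  unfold qterm.
  destruct (filtered_dshift _ _ _ (S k) (hsym_qlist_filtered a b (S k))) as [_ [_ HS]].
  rewrite HS. clear HS.
  change (dshift (S k) (fun m => (b ^ m * hsym (qlist a b 1 (S k)) m)%C) (S (S n)))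
    with (dshift k (fun m => (b ^ m * hsym (qlist a b 1 (S k)) m)%C) n).
  pose proof (dshift_twist b (hsym (qlist a b 1 (S k))) k n) as HT.
  set (D := dshift k (fun m => (b ^ m * hsym (qlist a b 1 (S k)) m)%C) n) in *.
  set (U := dshift k (hsym (qlist a b 1 (S k))) n) in *.
  cbn [qphase Cpow].
  transitivity ((1 + a) * (b ^ (2 * k) * qphase b k * (y * y ^ k)
      * dshift (S k) (hsym (qlist a b 1 (S (S k)))) (S n))
    - a * (b ^ (2 * k) * qphase b k * (y * y ^ k)
      * dshift (S k) (hsym (qlist a b 1 (S (S k)))) n)
    + qphase b k * (y * y ^ k) * (b ^ (2 * k) * D))%C; [ring|].
  rewrite HT. ring.
Qed.

Lemma fundamental_expansion (a b y : C) (x : nat -> C) (n N : nat) :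
  fundamental a b y x -> (n < N)%nat -> x n = csum (qterm a b y n) N.
Proof.
  intros [H0 [H1 HS]]. revert N.
  assert (Z : forall n N, (n < 2)%nat -> csum (fun k => qterm a b y n (S k)) N = 0%C).
  { intros m N Hm. rewrite (csum_ext _ (fun _ => 0 * 0)%C).
    - rewrite csum_scal. ring.
    - intros j _. unfold qterm. destruct m as [|[|m]]; [| |lia]; cbn [dshift]; ring. }
  induction n as [n IH] using lt_wf_ind. intros [|N] HN; [lia|].
  rewrite csum_shift.
  destruct n as [|[|n]].
  - rewrite Z by lia. rewrite H0. unfold qterm. cbn [dshift]. rewrite hsym_0. simpl. ring.
  - rewrite Z by lia. rewrite H1. unfold qterm. simpl. ring.
  - rewrite (csum_ext _ (fun k => ((1 + a) * qterm a b y (S n) (S k)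
        + (- a) * qterm a b y n (S k)) + b ^ n * y * qterm a b y n k)%C)
      by (intros; rewrite qterm_S_step; ring).
    rewrite !csum_plus, !csum_scal, qterm_0_step, HS.
    rewrite (IH (S n)) with (N := S N) by lia.
    (* The two occurrences of [x n] are expanded to different lengths: the factor [y] raises the
       degree by one, so the second sum has one term fewer. *)
    replace ((a - b ^ n * y) * x n)%C with (a * x n - b ^ n * y * x n)%C by ring.
    rewrite (IH n) with (N := S N) at 1 by lia.
    rewrite (IH n) with (N := N) by lia.
    rewrite !csum_shift. ring.
Qed.

Lemma fundamental_growth (a b : C) (eta : R) :
  Cmod a = 1 -> Cmod b = 1 -> (forall j, (b ^ S j)%C <> 1%C) -> 0 < eta ->
  exists M, 0 < M /\ forall y x Y n,
    fundamental a b y x -> 1 <= Y -> Cmod y <= Y ^ 2 ->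
    Cmod (x n) <= M * exp (eta * INR n) * Y ^ n.
Proof.
  intros Ha Hb Hirr Heta.
  (* One third of [eta] pays for the length of the list, one for the degree of the symmetric
     function, one for the number [n + 1] of terms. *)
  set (e := eta / 3). assert (He : 0 < e) by (unfold e; lra).
  destruct (hsym_qlist_subexponential a b e Ha Hb Hirr He) as [M [HM HB]].
  set (rho := exp e) in *.
  assert (Hrho : 1 < rho) by (rewrite <- exp_0; apply exp_increasing; lra).
  exists (M * rho * (1 + / e)).
  assert (He' : 0 < / e) by (apply Rinv_0_lt_compat; lra).
  split; [apply Rmult_lt_0_compat; [apply Rmult_lt_0_compat|]; lra|].
  intros y x Y n Hx HY Hy.
  rewrite (fundamental_expansion a b y x n (S n) Hx) by lia.
  pose proof (pow_lt rho n ltac:(lra)) as Hrn.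
  pose proof (pow_lt Y n ltac:(lra)) as HYn.
  apply Rle_trans with (rsum (fun _ => M * rho * rho ^ n * rho ^ n * Y ^ n) (S n)).
  - apply csum_Cmod. intros k Hk. unfold qterm.
    rewrite !Cmod_mult, Cmod_qphase, Cmod_pow, Rmult_1_l by assumption.
    eapply Rle_trans.
    + apply dshift_bound with (B := M * rho ^ S k) (rho := rho) (Y := Y); try lra.
      * split; [apply Cmod_ge_0|exact Hy].
      * apply Rmult_le_pos; [lra|apply pow_le; lra].
      * apply HB.
    + apply Rmult_le_compat_r; [lra|]. apply Rmult_le_compat_r; [lra|].
      rewrite Rmult_assoc. apply Rmult_le_compat_l; [lra|].
      change (rho ^ S k) with (rho * rho ^ k). apply Rmult_le_compat_l; [lra|].
      apply Rle_pow; [lra|lia].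
  - rewrite rsum_const, S_INR.
    assert (En : exp (eta * INR n) = rho ^ n * rho ^ n * rho ^ n).
    { unfold rho. rewrite <- !exp_mult_nat, <- !exp_plus. f_equal. unfold e. lra. }
    rewrite En.
    assert (Hn : INR n + 1 <= (1 + / e) * rho ^ n).
    { unfold rho. rewrite <- exp_mult_nat. pose proof (pos_INR n).
      apply Rle_trans with ((1 + / e) * (1 + e * INR n)).
      - replace ((1 + / e) * (1 + e * INR n)) with (1 + e * INR n + / e + INR n) by (field; lra).
        assert (0 <= e * INR n) by (apply Rmult_le_pos; lra). lra.
      - apply Rmult_le_compat_l; [lra|]. apply exp_ineq1_le. }
    replace (M * rho * (1 + / e) * (rho ^ n * rho ^ n * rho ^ n) * Y ^ n)
      with (((1 + / e) * rho ^ n) * (M * rho * rho ^ n * rho ^ n * Y ^ n)) by ring.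
    apply Rmult_le_compat_r; [|exact Hn].
    repeat apply Rmult_le_pos; lra.
Qed.

(** * Operator norm and cocycle iterates *)

Definition cnorm2 (u v : C) : R := sqrt (Cmod u ^ 2 + Cmod v ^ 2).

(** [cnorm2] is, up to conversion, the norm of the product of two copies of the normed module of
    complex numbers. *)
Lemma cnorm2_triangle (u v u' v' : C) :
  cnorm2 (u + u')%C (v + v')%C <= cnorm2 u v + cnorm2 u' v'.
Proof.
  exact (@norm_triangle C_AbsRing
    (prod_NormedModule C_AbsRing (AbsRing_NormedModule C_AbsRing)
                                 (AbsRing_NormedModule C_AbsRing)) (u, v) (u', v')).
Qed.

Lemma cnorm2_le_sum (u v : C) : cnorm2 u v <= Cmod u + Cmod v.
Proof.
  pose proof (Cmod_ge_0 u). pose proof (Cmod_ge_0 v). unfold cnorm2.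
  rewrite <- (sqrt_pow2 (Cmod u + Cmod v)) by lra. apply sqrt_le_1_alt. nra.
Qed.

Lemma Cmod_le_1_unit (u v : C) : Cmod u ^ 2 + Cmod v ^ 2 = 1 -> Cmod u <= 1 /\ Cmod v <= 1.
Proof. pose proof (Cmod_ge_0 u). pose proof (Cmod_ge_0 v). split; nra. Qed.

Definition entry_sum (M : mat2) : R :=
  Cmod (m11 M) + Cmod (m12 M) + Cmod (m21 M) + Cmod (m22 M).

Lemma cnorm2_mat_le (M : mat2) (v1 v2 : C) :
  Cmod v1 ^ 2 + Cmod v2 ^ 2 = 1 ->
  cnorm2 (m11 M * v1 + m12 M * v2)%C (m21 M * v1 + m22 M * v2)%C <= entry_sum M.
Proof.
  intros H. destruct (Cmod_le_1_unit _ _ H) as [H1 H2].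
  eapply Rle_trans; [apply cnorm2_le_sum|]. unfold entry_sum.
  assert (P : forall x y : C, Cmod y <= 1 -> Cmod (x * y)%C <= Cmod x).
  { intros x y Hy. rewrite Cmod_mult. pose proof (Cmod_ge_0 x). nra. }
  pose proof (Cmod_triangle (m11 M * v1) (m12 M * v2)).
  pose proof (Cmod_triangle (m21 M * v1) (m22 M * v2)).
  pose proof (P (m11 M) v1 H1). pose proof (P (m12 M) v2 H2).
  pose proof (P (m21 M) v1 H1). pose proof (P (m22 M) v2 H2). lra.
Qed.

(** The set of values is nonempty and bounded by [entry_sum M], so its least upper bound is finite
    and [real] returns it rather than a default value. *)
Lemma opnorm_lub (M : mat2) :
  is_lub_Rbar (fun r => exists v1 v2 : C,
     Cmod v1 ^ 2 + Cmod v2 ^ 2 = 1 /\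
     r = cnorm2 (m11 M * v1 + m12 M * v2)%C (m21 M * v1 + m22 M * v2)%C)
   (Finite (opnorm M)).
Proof.
  unfold opnorm.
  match goal with |- context [Lub_Rbar ?E] =>
    change E with (fun r => exists v1 v2 : C,
     Cmod v1 ^ 2 + Cmod v2 ^ 2 = 1 /\
     r = cnorm2 (m11 M * v1 + m12 M * v2)%C (m21 M * v1 + m22 M * v2)%C) end.
  set (E := fun r : R => _). pose proof (Lub_Rbar_correct E) as L.
  assert (Hne : E (cnorm2 (m11 M * 1 + m12 M * 0)%C (m21 M * 1 + m22 M * 0)%C)).
  { exists 1%C, 0%C. split; [|reflexivity]. rewrite Cmod_1, Cmod_0. ring. }
  assert (Hub : is_ub_Rbar E (Finite (entry_sum M))).
  { intros r [v1 [v2 [H ->]]]. apply cnorm2_mat_le, H. }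
  destruct L as [U L]. specialize (U _ Hne). specialize (L _ Hub).
  pose proof (Lub_Rbar_correct E) as L'.
  destruct (Lub_Rbar E); simpl in *; [exact L'|contradiction|contradiction].
Qed.

Lemma opnorm_ge (M : mat2) (v1 v2 : C) :
  Cmod v1 ^ 2 + Cmod v2 ^ 2 = 1 ->
  cnorm2 (m11 M * v1 + m12 M * v2)%C (m21 M * v1 + m22 M * v2)%C <= opnorm M.
Proof.
  intros H. destruct (opnorm_lub M) as [U _]. apply (U _).
  exists v1, v2. auto.
Qed.

Lemma opnorm_le (M : mat2) (B : R) :
  (forall v1 v2 : C, Cmod v1 ^ 2 + Cmod v2 ^ 2 = 1 ->
    cnorm2 (m11 M * v1 + m12 M * v2)%C (m21 M * v1 + m22 M * v2)%C <= B) ->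
  opnorm M <= B.
Proof.
  intros H. destruct (opnorm_lub M) as [_ L]. apply (L (Finite B)).
  intros r [v1 [v2 [Hv ->]]]. apply H, Hv.
Qed.

Lemma opnorm_le_entry_sum (M : mat2) : opnorm M <= entry_sum M.
Proof. apply opnorm_le, cnorm2_mat_le. Qed.

Lemma opnorm_col1 (M : mat2) : cnorm2 (m11 M) (m21 M) <= opnorm M.
Proof.
  pose proof (opnorm_ge M 1 0) as H.
  replace (m11 M * 1 + m12 M * 0)%C with (m11 M) in H by ring.
  replace (m21 M * 1 + m22 M * 0)%C with (m21 M) in H by ring.
  apply H. rewrite Cmod_1, Cmod_0. ring.
Qed.

Lemma opnorm_col2 (M : mat2) : cnorm2 (m12 M) (m22 M) <= opnorm M.
Proof.
  pose proof (opnorm_ge M 0 1) as H.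
  replace (m11 M * 0 + m12 M * 1)%C with (m12 M) in H by ring.
  replace (m21 M * 0 + m22 M * 1)%C with (m22 M) in H by ring.
  apply H. rewrite Cmod_1, Cmod_0. ring.
Qed.

Lemma opnorm_ge_0 (M : mat2) : 0 <= opnorm M.
Proof. eapply Rle_trans; [apply sqrt_pos|apply opnorm_col1]. Qed.

Lemma cnorm2_pos (u v : C) : u <> 0%C \/ v <> 0%C -> 0 < cnorm2 u v.
Proof.
  intros H. unfold cnorm2. apply sqrt_lt_R0.
  pose proof (Cmod_ge_0 u). pose proof (Cmod_ge_0 v).
  destruct H as [H|H]; apply Cmod_gt_0 in H; nra.
Qed.

Definition mat2_zero : mat2 := Mat2 0%C 0%C 0%C 0%C.

Lemma opnorm_pos (M : mat2) : M <> mat2_zero -> 0 < opnorm M.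
Proof.
  intros H. destruct (Rle_lt_or_eq_dec _ _ (opnorm_ge_0 M)) as [H0|H0]; [exact H0|].
  exfalso. apply H.
  assert (Z : forall u v, cnorm2 u v <= opnorm M -> u = 0%C /\ v = 0%C).
  { intros u v Huv. rewrite <- H0 in Huv.
    destruct (Ceq_dec u 0) as [Hu|Hu]; [destruct (Ceq_dec v 0) as [Hv|Hv]; [auto|]|].
    - pose proof (cnorm2_pos u v (or_intror Hv)). lra.
    - pose proof (cnorm2_pos u v (or_introl Hu)). lra. }
  destruct (Z _ _ (opnorm_col1 M)) as [E1 E2]. destruct (Z _ _ (opnorm_col2 M)) as [E3 E4].
  destruct M. simpl in *. subst. reflexivity.
Qed.

Definition mat2_det (M : mat2) : C := (m11 M * m22 M - m12 M * m21 M)%C.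

Lemma mat2_det_mul (M N : mat2) :
  mat2_det (mat2_mul M N) = (mat2_det M * mat2_det N)%C.
Proof. unfold mat2_det. simpl. ring. Qed.

(** Hadamard's inequality: the determinant is bounded by the product of the column norms. The defect
    in the Cauchy-Schwarz step is the square [(x y - z t)^2]. *)
Lemma Cmod_det_le (M : mat2) : Cmod (mat2_det M) <= opnorm M ^ 2.
Proof.
  pose proof (opnorm_col1 M) as H1. pose proof (opnorm_col2 M) as H2.
  apply Rle_trans with (cnorm2 (m11 M) (m21 M) * cnorm2 (m12 M) (m22 M)).
  2:{ simpl. rewrite Rmult_1_r. apply Rmult_le_compat; auto; apply sqrt_pos. }
  unfold mat2_det. eapply Rle_trans; [apply Cmod_minus_triangle|].
  rewrite !Cmod_mult.
  unfold cnorm2.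
  pose proof (Cmod_ge_0 (m11 M)). pose proof (Cmod_ge_0 (m12 M)).
  pose proof (Cmod_ge_0 (m21 M)). pose proof (Cmod_ge_0 (m22 M)).
  set (x := Cmod (m11 M)) in *. set (y := Cmod (m12 M)) in *.
  set (z := Cmod (m21 M)) in *. set (t := Cmod (m22 M)) in *.
  rewrite <- sqrt_mult by nra.
  rewrite <- (sqrt_pow2 (x * t + y * z)) by nra. apply sqrt_le_1_alt.
  assert (0 <= (x * y - z * t) ^ 2) by apply pow2_ge_0. nra.
Qed.

Lemma Cminus_eq_0 (x y : C) : (x - y = 0)%C -> x = y.
Proof. intros H. replace x with ((x - y) + y)%C by ring. rewrite H. ring. Qed.

Definition mat2_minus (M N : mat2) : mat2 :=
  Mat2 (m11 M - m11 N)%C (m12 M - m12 N)%C (m21 M - m21 N)%C (m22 M - m22 N)%C.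

Lemma opnorm_perturb (M N : mat2) : opnorm M <= opnorm N + entry_sum (mat2_minus M N).
Proof.
  apply opnorm_le. intros v1 v2 Hv.
  replace (m11 M * v1 + m12 M * v2)%C
    with ((m11 N * v1 + m12 N * v2)
      + (m11 (mat2_minus M N) * v1 + m12 (mat2_minus M N) * v2))%C by (simpl; ring).
  replace (m21 M * v1 + m22 M * v2)%C
    with ((m21 N * v1 + m22 N * v2)
      + (m21 (mat2_minus M N) * v1 + m22 (mat2_minus M N) * v2))%C by (simpl; ring).
  eapply Rle_trans; [apply cnorm2_triangle|].
  apply Rplus_le_compat; [apply opnorm_ge, Hv|apply cnorm2_mat_le, Hv].
Qed.

(** * Iterates of the cocycle: growth and non-vanishing *)

Lemma cocycle_iter_right (Cc : C -> mat2) (g : C) (n : nat) (y : C) :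
  cocycle_iter Cc g (S n) y = mat2_mul (cocycle_iter Cc g n (g * y)%C) (Cc y).
Proof.
  induction n as [|n IH].
  - simpl. unfold mat2_mul, mat2_id. simpl. rewrite Cmult_1_l. f_equal; ring.
  - change (cocycle_iter Cc g (S (S n)) y)
      with (mat2_mul (Cc (g ^ S n * y)%C) (cocycle_iter Cc g (S n) y)).
    rewrite IH. cbn [cocycle_iter].
    replace (g ^ n * (g * y))%C with (g ^ S n * y)%C by (simpl; ring).
    unfold mat2_mul. simpl. f_equal; ring.
Qed.

(** The bottom row [(1, 1)] gives [m11] as a difference of consecutive values of [m21], and
    eliminating it leaves a second-order recursion. Starting at the first iterate replaces [y] by
    [b * y]. *)
Lemma m21_fundamental (a b y : C) :
  fundamental a b (b * y) (fun n => m21 (cocycle_iter (matA a) b (S n) y)).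
Proof.
  split; [|split].
  - simpl. ring.
  - simpl. ring.
  - intros n. set (N := cocycle_iter (matA a) b (S n) y).
    change (cocycle_iter (matA a) b (S (S n)) y)
      with (mat2_mul (matA a (b ^ S n * y)%C) N).
    change (cocycle_iter (matA a) b (S (S (S n))) y)
      with (mat2_mul (matA a (b ^ S (S n) * y)%C) (mat2_mul (matA a (b ^ S n * y)%C) N)).
    clearbody N. simpl. ring.
Qed.

Lemma cocycle_matA_growth (a b : C) (eta Y : R) :
  Cmod a = 1 -> Cmod b = 1 -> (forall j, (b ^ S j)%C <> 1%C) -> 0 < eta -> 1 <= Y ->
  exists M, 0 < M /\ forall y n, Cmod y <= Y ^ 2 ->
    opnorm (cocycle_iter (matA a) b n y) <= M * exp (eta * INR n) * Y ^ n.
Proof.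
  intros Ha Hb Hirr Heta HY.
  destruct (fundamental_growth a b eta Ha Hb Hirr Heta) as [M [HM HG]].
  assert (Hb0 : b <> 0%C) by (apply Cmod_gt_0; lra).
  set (K := exp eta * Y).
  assert (HK : 1 <= K).
  { unfold K. pose proof (exp_ineq1_le eta). nra. }
  exists (9 * M * K). split; [nra|].
  (* The constant is [9 = 2 + 4 + 1 + 2], from the bounds on [m11], [m12], [m21] and [m22] by
     multiples of [G (S n)]. *)
  intros y n Hy. set (G := fun n => M * K ^ n).
  replace (9 * M * K * exp (eta * INR n) * Y ^ n) with (9 * G (S n)).
  2:{ unfold G, K. rewrite exp_mult_nat. simpl. rewrite Rpow_mult_distr. ring. }
  assert (GS : forall n, 0 <= G n <= G (S n)).
  { intros m. unfold G. simpl. pose proof (pow_lt K m ltac:(lra)).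
    assert (0 < M * K ^ m) by (apply Rmult_lt_0_compat; lra). nra. }
  set (m := fun n y => cocycle_iter (matA a) b n y) in *.
  assert (B21' : forall n y, Cmod y <= Y ^ 2 -> Cmod (m21 (m (S n) y)) <= G n).
  { intros k z Hz. unfold m, G.
    pose proof (HG _ _ Y k (m21_fundamental a b z) HY) as H.
    rewrite Cmod_mult, Hb, Rmult_1_l in H. specialize (H Hz).
    rewrite exp_mult_nat in H. unfold K. rewrite Rpow_mult_distr, <- Rmult_assoc. exact H. }
  assert (B21 : forall n y, Cmod y <= Y ^ 2 -> Cmod (m21 (m n y)) <= G n).
  { intros [|k] z Hz.
    - simpl. rewrite Cmod_0. apply GS.
    - eapply Rle_trans; [apply B21', Hz|apply GS]. }
  (* Started one step earlier, at [z / b], the iterate of length [k + 1] has lower left entry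
     [m21 * a + m22]; this isolates [m22]. *)
  assert (B22 : forall n y, Cmod y <= Y ^ 2 -> Cmod (m22 (m n y)) <= 2 * G n).
  { intros k z Hz.
    assert (Hz' : Cmod (z / b)%C <= Y ^ 2) by (rewrite Cmod_div, Hb by auto; lra).
    pose proof (B21' k _ Hz') as H1. pose proof (B21 k _ Hz) as H2.
    unfold m in *. rewrite cocycle_iter_right in H1.
    replace (b * (z / b))%C with z in H1 by (field; auto). simpl in H1.
    set (N := cocycle_iter (matA a) b k z) in *.
    replace (m22 N) with ((m21 N * a + m22 N * 1) - m21 N * a)%C by ring.
    eapply Rle_trans; [apply Cmod_minus_triangle|].
    rewrite (Cmod_mult (m21 N) a), Ha. lra. }
  (* The top row is the difference between the bottom rows of the iterates of lengths [n + 1] and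
     [n]. *)
  assert (B11 : Cmod (m11 (m n y)) <= 2 * G n).
  { pose proof (B21' n y Hy) as H1. pose proof (B21 n y Hy) as H2.
    unfold m in *. simpl in H1. set (N := cocycle_iter (matA a) b n y) in *.
    replace (m11 N) with ((1 * m11 N + 1 * m21 N) - m21 N)%C by ring.
    eapply Rle_trans; [apply Cmod_minus_triangle|]. lra. }
  assert (B12 : Cmod (m12 (m n y)) <= 2 * G (S n) + 2 * G n).
  { pose proof (B22 (S n) y Hy) as H1. pose proof (B22 n y Hy) as H2.
    unfold m in *. simpl in H1. set (N := cocycle_iter (matA a) b n y) in *.
    replace (m12 N) with ((1 * m12 N + 1 * m22 N) - m22 N)%C by ring.
    eapply Rle_trans; [apply Cmod_minus_triangle|]. lra. }
  eapply Rle_trans; [apply opnorm_le_entry_sum|]. unfold entry_sum.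
  specialize (B21 n y Hy). specialize (B22 n y Hy). specialize (GS n).
  fold (m n y). lra.
Qed.

Lemma det_matA (a y : C) : mat2_det (matA a y) = (a - y)%C.
Proof. unfold mat2_det. simpl. ring. Qed.

(** Multiplying by the adjugate of [M] shows that the determinant annihilates every entry of [N]. *)
Lemma mat2_mul_zero_l (M N : mat2) :
  mat2_mul M N = mat2_zero -> mat2_det M <> 0%C -> N = mat2_zero.
Proof.
  destruct M as [p q r s], N as [e f g h]. unfold mat2_mul, mat2_zero, mat2_det. simpl.
  intros E D.
  pose proof (f_equal m11 E) as E1. pose proof (f_equal m12 E) as E2.
  pose proof (f_equal m21 E) as E3. pose proof (f_equal m22 E) as E4.
  cbn [m11 m12 m21 m22] in E1, E2, E3, E4.
  assert (Z : forall w, ((p * s - q * r) * w = 0 -> w = 0)%C).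
  { intros w Hw. destruct (Ceq_dec w 0) as [|Hn]; [assumption|].
    exfalso. apply (Cmult_neq_0 _ _ D Hn Hw). }
  f_equal; apply Z.
  - transitivity (s * (p * e + q * g) - q * (r * e + s * g))%C; [ring|rewrite E1, E3; ring].
  - transitivity (s * (p * f + q * h) - q * (r * f + s * h))%C; [ring|rewrite E2, E4; ring].
  - transitivity (p * (r * e + s * g) - r * (p * e + q * g))%C; [ring|rewrite E1, E3; ring].
  - transitivity (p * (r * f + s * h) - r * (p * f + q * h))%C; [ring|rewrite E2, E4; ring].
Qed.

Lemma mat2_mul_zero_r (M N : mat2) :
  mat2_mul M N = mat2_zero -> mat2_det N <> 0%C -> M = mat2_zero.
Proof.
  destruct M as [e f g h], N as [p q r s]. unfold mat2_mul, mat2_zero, mat2_det. simpl.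
  intros E D.
  pose proof (f_equal m11 E) as E1. pose proof (f_equal m12 E) as E2.
  pose proof (f_equal m21 E) as E3. pose proof (f_equal m22 E) as E4.
  cbn [m11 m12 m21 m22] in E1, E2, E3, E4.
  assert (Z : forall w, ((p * s - q * r) * w = 0 -> w = 0)%C).
  { intros w Hw. destruct (Ceq_dec w 0) as [|Hn]; [assumption|].
    exfalso. apply (Cmult_neq_0 _ _ D Hn Hw). }
  f_equal; apply Z.
  - transitivity (s * (e * p + f * r) - r * (e * q + f * s))%C; [ring|rewrite E1, E2; ring].
  - transitivity (p * (e * q + f * s) - q * (e * p + f * r))%C; [ring|rewrite E1, E2; ring].
  - transitivity (s * (g * p + h * r) - r * (g * q + h * s))%C; [ring|rewrite E3, E4; ring].
  - transitivity (p * (g * q + h * s) - q * (g * p + h * r))%C; [ring|rewrite E3, E4; ring].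
Qed.

(* Along an orbit at most one factor [matA a (b ^ i * y)] is singular, so a
   vanishing product would force that factor itself to vanish. *)
Lemma cocycle_matA_nonzero (a b y : C) (n : nat) :
  b <> 0%C -> y <> 0%C -> (forall j, (b ^ S j)%C <> 1%C) ->
  cocycle_iter (matA a) b n y <> mat2_zero.
Proof.
  intros Hb Hy Hirr.
  (* The invariant records where the singular factor occurred: as [b] is not a root of unity, a
     position [i < n] with [b^i y = a] makes the factor at [n] invertible. *)
  enough (H : mat2_det (cocycle_iter (matA a) b n y) <> 0%C \/
    ((exists i, (i < n)%nat /\ (b ^ i * y)%C = a) /\
     cocycle_iter (matA a) b n y <> mat2_zero)).
  { destruct H as [H|[_ H]]; [|exact H]. intros E. apply H. rewrite E.
    unfold mat2_det. simpl. ring. }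
  induction n as [|n IH].
  - left. unfold mat2_det. simpl.
    replace (1 * 1 - 0 * 0)%C with (RtoC 1) by ring. apply C1_nz.
  - cbn [cocycle_iter]. destruct IH as [IH|[[i [Hi Ei]] IH]].
    + destruct (Ceq_dec (b ^ n * y)%C a) as [E|E].
      * right. split; [exists n; split; [lia|exact E]|].
        intros Z. apply mat2_mul_zero_r in Z; [|exact IH].
        apply (f_equal m21) in Z. exact (C1_nz Z).
      * left. rewrite mat2_det_mul, det_matA. apply Cmult_neq_0; [|exact IH].
        intros Z. apply E. symmetry. apply Cminus_eq_0, Z.
    + right. split; [exists i; split; [lia|exact Ei]|].
      intros Z. apply mat2_mul_zero_l in Z; [exact (IH Z)|].
      rewrite det_matA, <- Ei. replace n with (i + S (n - i - 1))%nat by lia.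
      rewrite Cpow_add_r. set (k := (n - i - 1)%nat). intros D.
      assert (Q : (b ^ i * y * (1 - b ^ S k) = 0)%C) by (rewrite <- D; ring).
      apply (Cmult_neq_0 (b ^ i * y)%C (1 - b ^ S k)%C); [| |exact Q].
      * apply Cmult_neq_0; [apply Cpow_nz|]; assumption.
      * intros Z0. apply (Hirr k). symmetry. apply Cminus_eq_0, Z0.
Qed.

(** * Lower bound by dyadic averaging *)

Lemma cis_plus (x y : R) : cis (x + y) = (cis x * cis y)%C.
Proof. unfold cis, Cmult. simpl. rewrite cos_plus, sin_plus. f_equal; ring. Qed.

Lemma Cmod_cis (x : R) : Cmod (cis x) = 1.
Proof.
  transitivity (sqrt 1); [|apply sqrt_1]. unfold Cmod, cis. cbn [fst snd]. f_equal.
  pose proof (sin2_cos2 x) as H. unfold Rsqr in H. lra.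
Qed.

Lemma cis_0 : cis 0 = 1%C.
Proof. unfold cis. rewrite cos_0, sin_0. reflexivity. Qed.

Lemma cis_pow (x : R) (n : nat) : (cis x ^ n)%C = cis (INR n * x).
Proof.
  induction n as [|n IH].
  - simpl. rewrite Rmult_0_l, cis_0. reflexivity.
  - rewrite S_INR, Rmult_plus_distr_r, Rmult_1_l, Rplus_comm, cis_plus, <- IH. reflexivity.
Qed.

Lemma cis_plus_PI (x : R) : cis (x + PI) = (- cis x)%C.
Proof. unfold cis, Copp. simpl. rewrite neg_cos, neg_sin. reflexivity. Qed.

Lemma cis_period (x : R) : cis (x + 2 * PI) = cis x.
Proof.
  replace (x + 2 * PI) with ((x + PI) + PI) by ring. rewrite !cis_plus_PI. ring.
Qed.

Lemma cis_irrational (theta : R) (j : nat) :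
  irrational theta -> (cis (2 * PI * theta) ^ S j)%C <> 1%C.
Proof.
  (* The imaginary part suffices: a zero of the sine at [2 PI (j + 1) theta] gives
     [theta = k / (2 (j + 1))]. *)
  intros Hirr H. rewrite cis_pow in H. apply (f_equal snd) in H.
  cbn [cis snd RtoC] in H. apply sin_eq_0_0 in H. destruct H as [k Hk].
  apply (Hirr k (2 * Z.of_nat (S j))%Z); [lia|].
  rewrite mult_IZR, <- INR_IZR_INZ.
  assert (0 < INR (S j)) by (apply lt_0_INR; lia).
  assert (HP := PI_RGT_0).
  apply Rmult_eq_reg_r with (INR (S j) * (2 * PI)); [|nra].
  transitivity (IZR k * PI); [rewrite <- Hk; ring|field; lra].
Qed.

Fixpoint cprod (f : nat -> C) (n : nat) : C :=
  match n with O => 1%C | S m => (cprod f m * f m)%C end.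

Lemma cprod_mult (f g : nat -> C) (n : nat) :
  cprod (fun i => f i * g i)%C n = (cprod f n * cprod g n)%C.
Proof. induction n as [|n IH]; simpl; [|rewrite IH]; ring. Qed.

Lemma cprod_ext (f g : nat -> C) (n : nat) :
  (forall i, f i = g i) -> cprod f n = cprod g n.
Proof. intros H. induction n as [|n IH]; simpl; [|rewrite IH, H]; reflexivity. Qed.

Lemma Cmod_cprod_const (f : nat -> C) (r : R) (n : nat) :
  (forall i, Cmod (f i) = r) -> Cmod (cprod f n) = r ^ n.
Proof.
  intros H. induction n as [|n IH]; simpl; [apply Cmod_1|].
  rewrite Cmod_mult, IH, H. ring.
Qed.

(** One sequence of coefficients serves every [z] and every truncation [N > n], which allows [N] to
    be a power of two later. *)
Lemma cprod_expand (a b : nat -> C) (n : nat) :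
  exists q : nat -> C, q 0%nat = cprod a n /\
    forall z N, (n < N)%nat ->
      cprod (fun i => a i - b i * z)%C n = csum (fun k => q k * z ^ k)%C N.
Proof.
  induction n as [|n [q [Hq IH]]].
  - exists (fun k => match k with O => 1%C | S _ => 0%C end). split; [reflexivity|].
    intros z [|N] HN; [lia|]. rewrite csum_shift.
    rewrite (csum_ext _ (fun _ => 0 * 0)%C) by (intros; simpl; ring).
    rewrite csum_scal. simpl. ring.
  - exists (fun k => match k with O => a n * q 0%nat | S k' => a n * q k - b n * q k' end)%C.
    split; [simpl; rewrite Hq; ring|].
    intros z [|N] HN; [lia|]. cbn [cprod].
    replace (cprod (fun i => a i - b i * z) n * (a n - b n * z))%C
      with (a n * cprod (fun i => a i - b i * z) n
            + - (b n * z) * cprod (fun i => a i - b i * z) n)%C by ring.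
    rewrite (IH z (S N)) at 1 by lia. rewrite (IH z N) by lia.
    rewrite !csum_shift, Cmult_plus_distr_l, <- !csum_scal, <- Cplus_assoc, <- csum_plus.
    f_equal; [ring|]. apply csum_ext. intros. simpl. ring.
Qed.

Lemma cis_half_sqr (s : R) : (cis (2 * PI * (s / 2)) * cis (2 * PI * (s / 2)))%C = cis (2 * PI * s).
Proof. rewrite <- cis_plus. f_equal. field. Qed.

Lemma cis_half_opp (s : R) : cis (2 * PI * (s / 2 + 1 / 2)) = (- cis (2 * PI * (s / 2)))%C.
Proof. rewrite <- cis_plus_PI. f_equal. field. Qed.

(* Averaging over [z] and [-z] keeps the even coefficients, so repeated averaging
   leaves only the constant one. *)
Lemma constant_coef_le_sup (m : nat) (q : nat -> C) (S : R) :
  (forall s, 0 <= s <= 1 ->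
     Cmod (csum (fun k => q k * cis (2 * PI * s) ^ k)%C (2 ^ m)) <= S) ->
  Cmod (q 0%nat) <= S.
Proof.
  revert q. induction m as [|m IH]; intros q H.
  - specialize (H 0 ltac:(lra)). simpl in H.
    replace (0 + q 0%nat * 1)%C with (q 0%nat) in H by ring. exact H.
  - apply (IH (fun k => q (2 * k)%nat)). intros s Hs.
    pose proof (H (s / 2) ltac:(lra)) as H1.
    pose proof (H (s / 2 + 1 / 2) ltac:(lra)) as H2.
    rewrite cis_half_opp in H2. rewrite <- cis_half_sqr.
    set (z := cis (2 * PI * (s / 2))) in *.
    change (2 ^ Datatypes.S m)%nat with (2 * 2 ^ m)%nat in H1, H2.
    rewrite csum_even_odd in H1, H2.
    set (E := csum (fun k => q (2 * k)%nat * (z * z) ^ k)%C (2 ^ m)).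
    set (O := csum (fun k => q (Datatypes.S (2 * k)) * z ^ (Datatypes.S (2 * k)))%C (2 ^ m)) in *.
    replace (csum (fun k => q (2 * k)%nat * z ^ (2 * k))%C (2 ^ m)) with E in H1.
    2:{ apply csum_ext. intros k _. rewrite Cpow_mult_r. f_equal. f_equal. simpl. ring. }
    replace (csum (fun k => q (2 * k)%nat * (- z) ^ (2 * k))%C (2 ^ m)) with E in H2.
    2:{ apply csum_ext. intros k _. rewrite Cpow_mult_r. f_equal. f_equal. simpl. ring. }
    replace (csum (fun k => q (Datatypes.S (2 * k)) * (- z) ^ (Datatypes.S (2 * k)))%C (2 ^ m))
      with (- (1) * O)%C in H2.
    2:{ unfold O. rewrite <- csum_scal. apply csum_ext. intros k _.
        rewrite !Cpow_S, !Cpow_mult_r.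
        replace ((- z) ^ 2)%C with (z ^ 2)%C by (simpl; ring). ring. }
    assert (D : (2 * E = (E + O) + (E + - (1) * O))%C) by ring.
    apply (f_equal Cmod) in D. rewrite Cmod_mult, Cmod_R, Rabs_pos_eq in D by lra.
    pose proof (Cmod_triangle (E + O) (E + - (1) * O)). lra.
Qed.

Lemma cprod_const_le_sup (a b : nat -> C) (n : nat) (S : R) :
  (forall s, 0 <= s <= 1 ->
     Cmod (cprod (fun i => a i - b i * cis (2 * PI * s))%C n) <= S) ->
  Cmod (cprod a n) <= S.
Proof.
  intros H. destruct (cprod_expand a b n) as [q [Hq HE]]. rewrite <- Hq.
  apply (constant_coef_le_sup n). intros s Hs. rewrite <- HE.
  - apply H, Hs.
  - apply Nat.pow_gt_lin_r. lia.
Qed.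

(** Replacing [z] by its inverse on the unit circle and extracting a unimodular factor exchanges [a]
    and [b], so the leading coefficient becomes a constant one. *)
Lemma cprod_lead_le_sup (a b : nat -> C) (n : nat) (S : R) :
  (forall s, 0 <= s <= 1 ->
     Cmod (cprod (fun i => a i - b i * cis (2 * PI * s))%C n) <= S) ->
  Cmod (cprod b n) <= S.
Proof.
  intros H. apply (cprod_const_le_sup b a). intros s Hs.
  (* The parameter [1 - s] gives the same point as [- s] and stays in [[0, 1]]. *)
  specialize (H (1 - s) ltac:(lra)).
  replace (cis (2 * PI * (1 - s))) with (cis (- (2 * PI * s))) in H.
  2:{ rewrite <- cis_period. f_equal. ring. }
  assert (E : (cis (2 * PI * s) * cis (- (2 * PI * s)) = 1)%C).
  { rewrite <- cis_plus, Rplus_opp_r. apply cis_0. }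
  set (z := cis (2 * PI * s)) in *. set (w := cis (- (2 * PI * s))) in *.
  assert (Hw : Cmod w = 1) by apply Cmod_cis.
  replace (Cmod (cprod (fun i => b i - a i * z)%C n))
    with (Cmod (cprod (fun i => a i - b i * w)%C n)); [exact H|].
  rewrite (cprod_ext _ (fun i => (- w) * (b i - a i * z))%C).
  - rewrite (cprod_mult (fun _ => - w)%C), Cmod_mult, (Cmod_cprod_const _ 1), pow1.
    + ring.
    + intros _. rewrite Cmod_opp. exact Hw.
  - intros i. transitivity (a i * (z * w) - b i * w)%C; [rewrite E|]; ring.
Qed.

(** The average of [f] over the two preimages of [s] under the doubling map of the circle. *)
Definition halve (f : R -> R) (s : R) : R := (f (s / 2) + f (s / 2 + 1 / 2)) / 2.

Lemma continuous_affine (f : R -> R) (u v : R) :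
  (forall x, continuous f x) -> forall x, continuous (fun y => f (u * y + v)) x.
Proof.
  intros Hf x. apply continuous_comp; [|apply Hf].
  apply (ex_derive_continuous (fun y => u * y + v)). auto_derive. exact I.
Qed.

Lemma continuous_halve (f : R -> R) :
  (forall x, continuous f x) -> forall x, continuous (halve f) x.
Proof.
  intros Hf x.
  apply continuous_ext with
    (fun s => plus (scal (1 / 2) (f (1 / 2 * s + 0))) (scal (1 / 2) (f (1 / 2 * s + 1 / 2)))).
  - intros s. unfold halve, plus, scal. simpl. unfold mult. simpl.
    replace (1 / 2 * s + 0) with (s / 2) by field.
    replace (1 / 2 * s + 1 / 2) with (s / 2 + 1 / 2) by field. field.
  - apply (continuous_plus (V := R_NormedModule));
      apply (continuous_scal_r (V := R_NormedModule)); apply continuous_affine, Hf.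
Qed.

Lemma ex_RInt_cont (f : R -> R) (u v : R) :
  (forall x, continuous f x) -> ex_RInt f u v.
Proof. intros Hf. apply (ex_RInt_continuous (V := R_CompleteNormedModule)). auto. Qed.

Lemma RInt_halve (f : R -> R) :
  (forall x, continuous f x) -> RInt (halve f) 0 1 = RInt f 0 1.
Proof.
  intros Hf.
  pose proof (RInt_comp_lin f (1 / 2) 0 0 1 (ex_RInt_cont f _ _ Hf)) as E1.
  pose proof (RInt_comp_lin f (1 / 2) (1 / 2) 0 1 (ex_RInt_cont f _ _ Hf)) as E2.
  replace (1 / 2 * 0 + 0) with 0 in E1 by field.
  replace (1 / 2 * 1 + 0) with (1 / 2) in E1 by field.
  replace (1 / 2 * 0 + 1 / 2) with (1 / 2) in E2 by field.
  replace (1 / 2 * 1 + 1 / 2) with 1 in E2 by field.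
  rewrite <- (RInt_Chasles f 0 (1 / 2) 1) by (apply ex_RInt_cont, Hf).
  rewrite <- E1, <- E2.
  rewrite <- (RInt_plus (V := R_CompleteNormedModule)).
  - apply RInt_ext. intros s _. unfold halve, plus, scal. simpl. unfold mult. simpl.
    replace (1 / 2 * s + 0) with (s / 2) by field.
    replace (1 / 2 * s + 1 / 2) with (s / 2 + 1 / 2) by field. field.
  - apply ex_RInt_cont. intros x.
    apply (continuous_scal_r (V := R_NormedModule)), continuous_affine, Hf.
  - apply ex_RInt_cont. intros x.
    apply (continuous_scal_r (V := R_NormedModule)), continuous_affine, Hf.
Qed.

(** Passing to [halve f] doubles [N] and [delta], and turns the factors into
    [(a - b z)(a + b z) = a^2 - b^2 z^2]. At [m = 0] one has [delta > 1], so [f] exceeds its mean by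
    at most [eps] on all of [[0, 1]], and the sup bounds for the extreme coefficients apply. *)
Lemma dyadic_jensen (m n : nat) (f : R -> R) (a b : nat -> C) (N delta eps : R) :
  (forall x, continuous f x) -> 0 < N ->
  (forall x y, 0 <= x <= 1 -> 0 <= y <= 1 -> Rabs (x - y) < delta ->
     Rabs (f x - f y) <= eps) ->
  1 < 2 ^ m * delta ->
  (forall s, 0 <= s <= 1 ->
     Cmod (cprod (fun i => a i - b i * cis (2 * PI * s))%C n) <= exp (N * f s)) ->
  Cmod (cprod a n) <= exp (N * (RInt f 0 1 + eps)) /\
  Cmod (cprod b n) <= exp (N * (RInt f 0 1 + eps)).
Proof.
  revert f a b N delta.
  induction m as [|m IH]; intros f a b N delta Hf HN Hosc Hd H.
  - assert (B : forall s, 0 <= s <= 1 ->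
      Cmod (cprod (fun i => a i - b i * cis (2 * PI * s))%C n)
      <= exp (N * (RInt f 0 1 + eps))).
    { intros s Hs. eapply Rle_trans; [apply H, Hs|].
      assert (K : f s - eps <= RInt f 0 1).
      { replace (f s - eps) with (RInt (fun _ => f s - eps) 0 1).
        - apply RInt_le; [lra|apply ex_RInt_const|apply ex_RInt_cont, Hf|].
          intros x Hx.
          assert (O : Rabs (f s - f x) <= eps).
          { apply Hosc; [lra|lra|]. simpl in Hd. apply Rabs_def1; lra. }
          apply Rabs_le_between in O. lra.
        - rewrite RInt_const. unfold scal. simpl. unfold mult. simpl. ring. }
      destruct (Rle_lt_or_eq_dec (f s) (RInt f 0 1 + eps)) as [L|L]; [lra| |].
      - left. apply exp_increasing, Rmult_lt_compat_l; lra.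
      - rewrite L. lra. }
    split; [apply (cprod_const_le_sup a b), B|apply (cprod_lead_le_sup a b), B].
  (* This takes the square root of the bounds that the induction yields for the squared
     coefficients. *)
  - assert (R2 : forall x y, 0 <= x -> x * x <= exp (2 * N * y) -> x <= exp (N * y)).
    { intros x y Hx Hxy. replace (2 * N * y) with (N * y + N * y) in Hxy by ring.
      rewrite exp_plus in Hxy. pose proof (exp_pos (N * y)). nra. }
    destruct (IH (halve f) (fun i => a i * a i)%C (fun i => b i * b i)%C (2 * N) (2 * delta))
      as [IHa IHb].
    + apply continuous_halve, Hf.
    + lra.
    + intros x y Hx Hy Hxy. unfold halve. apply Rabs_def2 in Hxy.
      assert (O1 : Rabs (f (x / 2) - f (y / 2)) <= eps).
      { apply Hosc; [lra|lra|apply Rabs_def1; lra]. }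
      assert (O2 : Rabs (f (x / 2 + 1 / 2) - f (y / 2 + 1 / 2)) <= eps).
      { apply Hosc; [lra|lra|apply Rabs_def1; lra]. }
      apply Rabs_le_between in O1. apply Rabs_le_between in O2.
      apply Rabs_le_between. lra.
    + simpl in Hd. lra.
    + intros s Hs.
      pose proof (H (s / 2) ltac:(lra)) as H1.
      pose proof (H (s / 2 + 1 / 2) ltac:(lra)) as H2.
      rewrite cis_half_opp in H2. rewrite <- cis_half_sqr.
      set (z := cis (2 * PI * (s / 2))) in *.
      rewrite (cprod_ext _ (fun i => (a i - b i * z) * (a i - b i * - z))%C)
        by (intros; ring).
      rewrite cprod_mult, Cmod_mult.
      replace (2 * N * halve f s) with (N * f (s / 2) + N * f (s / 2 + 1 / 2))
        by (unfold halve; field).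
      rewrite exp_plus. apply Rmult_le_compat; try apply Cmod_ge_0; assumption.
    + rewrite RInt_halve in IHa, IHb by exact Hf.
      rewrite cprod_mult, Cmod_mult in IHa, IHb.
      split; apply R2; try apply Cmod_ge_0; assumption.
Qed.

(** An inequality of Jensen type. Uniform continuity of [f] on [[0, 1]] provides [delta] for each
    [eps], a large [m] gives [2^m delta > 1], and [eps] then tends to [0]. *)
Lemma jensen_upper (n : nat) (f : R -> R) (a b : nat -> C) (N : R) :
  (forall x, continuous f x) -> 0 < N ->
  (forall s, Cmod (cprod (fun i => a i - b i * cis (2 * PI * s))%C n) <= exp (N * f s)) ->
  Cmod (cprod a n) <= exp (N * RInt f 0 1) /\ Cmod (cprod b n) <= exp (N * RInt f 0 1).
Proof.
  intros Hf HN H.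
  assert (K : forall eps, 0 < eps ->
    Cmod (cprod a n) <= exp (N * (RInt f 0 1 + eps)) /\
    Cmod (cprod b n) <= exp (N * (RInt f 0 1 + eps))).
  { intros eps Heps.
    destruct (Heine f (fun c => 0 <= c <= 1) (compact_P3 0 1)) with (eps := mkposreal eps Heps)
      as [delta Hd].
    { intros x _. apply continuity_pt_filterlim, Hf. }
    destruct (Pow_x_infinity 2) with (b := 2 / delta) as [m Hm].
    { rewrite Rabs_pos_eq; lra. }
    specialize (Hm m (Nat.le_refl m)).
    pose proof (cond_pos delta) as Hdp.
    rewrite Rabs_pos_eq in Hm by (apply pow_le; lra).
    apply (dyadic_jensen m) with (delta := delta); auto.
    - intros x y Hx Hy Hxy. left. apply (Hd x y Hx Hy Hxy).
    - apply Rge_le in Hm. apply Rmult_le_compat_r with (r := delta) in Hm; [|lra].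
      replace (2 / delta * delta) with 2 in Hm by (field; lra). lra. }
  assert (L : forall x, (forall eps, 0 < eps -> x <= exp (N * (RInt f 0 1 + eps))) ->
    x <= exp (N * RInt f 0 1)).
  { intros x Hx. apply Rnot_lt_le. intros Hlt.
    pose proof (exp_pos (N * RInt f 0 1)) as P.
    assert (E : N * RInt f 0 1 < ln x).
    { rewrite <- (ln_exp (N * RInt f 0 1)). apply ln_increasing; assumption. }
    (* Chosen so that [N (RInt f 0 1 + e)] is the midpoint of [N RInt f 0 1] and [ln x]. *)
    set (e := (ln x - N * RInt f 0 1) / (2 * N)).
    assert (He : 0 < e).
    { unfold e. apply Rmult_lt_0_compat; [lra|apply Rinv_0_lt_compat; lra]. }
    specialize (Hx e He).
    assert (Q : N * (RInt f 0 1 + e) < ln x).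
    { replace (N * (RInt f 0 1 + e)) with ((N * RInt f 0 1 + ln x) / 2)
        by (unfold e; field; lra). lra. }
    apply exp_increasing in Q. rewrite exp_ln in Q by lra. lra. }
  split; apply L; intros eps Heps; apply K, Heps.
Qed.

(** * Continuity of the logarithm of the norm *)

(** Componentwise, so that only continuity of real functions has to be handled. *)
Definition ccont (g : R -> C) (t : R) : Prop :=
  continuous (fun x => fst (g x)) t /\ continuous (fun x => snd (g x)) t.

Lemma ccont_const (c : C) (t : R) : ccont (fun _ => c) t.
Proof. split; apply continuous_const. Qed.

Lemma ccont_plus (f g : R -> C) (t : R) :
  ccont f t -> ccont g t -> ccont (fun x => f x + g x)%C t.
Proof.
  intros [F1 F2] [G1 G2].
  split; [exact (continuous_plus _ _ t F1 G1)|exact (continuous_plus _ _ t F2 G2)].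
Qed.

Lemma ccont_mult (f g : R -> C) (t : R) :
  ccont f t -> ccont g t -> ccont (fun x => f x * g x)%C t.
Proof.
  intros [F1 F2] [G1 G2]. split.
  - exact (continuous_minus _ _ t (continuous_mult _ _ t F1 G1) (continuous_mult _ _ t F2 G2)).
  - exact (continuous_plus _ _ t (continuous_mult _ _ t F1 G2) (continuous_mult _ _ t F2 G1)).
Qed.

Lemma ccont_cis (u t : R) : ccont (fun x => cis (u * x)) t.
Proof.
  split.
  - apply (ex_derive_continuous (fun x => cos (u * x))). auto_derive. exact I.
  - apply (ex_derive_continuous (fun x => sin (u * x))). auto_derive. exact I.
Qed.

Lemma continuous_Cmod (f : R -> C) (t : R) : ccont f t -> continuous (fun x => Cmod (f x)) t.
Proof.
  intros [F1 F2]. unfold Cmod.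
  apply (continuous_comp _ sqrt); [|apply continuous_sqrt].
  apply continuous_ext with (fun x => fst (f x) * fst (f x) + snd (f x) * snd (f x)).
  - intros x. simpl. ring.
  - exact (continuous_plus _ _ t (continuous_mult _ _ t F1 F1) (continuous_mult _ _ t F2 F2)).
Qed.

Definition mcont (M : R -> mat2) (t : R) : Prop :=
  ccont (fun x => m11 (M x)) t /\ ccont (fun x => m12 (M x)) t /\
  ccont (fun x => m21 (M x)) t /\ ccont (fun x => m22 (M x)) t.

Lemma mcont_mul (M N : R -> mat2) (t : R) :
  mcont M t -> mcont N t -> mcont (fun x => mat2_mul (M x) (N x)) t.
Proof.
  intros [A1 [A2 [A3 A4]]] [B1 [B2 [B3 B4]]].
  assert (K : forall f g h k, ccont f t -> ccont g t -> ccont h t -> ccont k t ->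
    ccont (fun x => f x * g x + h x * k x)%C t).
  { intros. apply ccont_plus; apply ccont_mult; assumption. }
  split; [|split; [|split]].
  - exact (K _ _ _ _ A1 B1 A2 B3).
  - exact (K _ _ _ _ A1 B2 A2 B4).
  - exact (K _ _ _ _ A3 B1 A4 B3).
  - exact (K _ _ _ _ A3 B2 A4 B4).
Qed.

Lemma entry_sum_minus_sym (M N : mat2) :
  entry_sum (mat2_minus M N) = entry_sum (mat2_minus N M).
Proof.
  unfold entry_sum. simpl.
  assert (S : forall x y, Cmod (x - y)%C = Cmod (y - x)%C).
  { intros x y. rewrite <- Cmod_opp. f_equal. ring. }
  rewrite (S (m11 M)), (S (m12 M)), (S (m21 M)), (S (m22 M)). reflexivity.
Qed.

(** The variation of the norm is at most the sum of the moduli of the entry differences, which is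
    continuous and vanishes at [t]. *)
Lemma continuous_opnorm (M : R -> mat2) (t : R) :
  mcont M t -> continuous (fun x => opnorm (M x)) t.
Proof.
  intros [A1 [A2 [A3 A4]]].
  set (g := fun x => entry_sum (mat2_minus (M x) (M t))).
  assert (G : continuous g t).
  { unfold g, entry_sum. simpl.
    assert (K : forall f c, ccont f t -> continuous (fun x => Cmod (f x - c)%C) t).
    { intros f c Hf. apply continuous_Cmod, ccont_plus; [exact Hf|apply ccont_const]. }
    exact (continuous_plus _ _ t (continuous_plus _ _ t (continuous_plus _ _ t
      (K _ (m11 (M t)) A1) (K _ (m12 (M t)) A2)) (K _ (m21 (M t)) A3)) (K _ (m22 (M t)) A4)). }
  assert (G0 : g t = 0).
  { unfold g, entry_sum. simpl.
    assert (Z : forall x, Cmod (x - x)%C = 0).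
    { intros x. replace (x - x)%C with (RtoC 0) by ring. apply Cmod_0. }
    rewrite !Z. ring. }
  apply filterlim_locally. intros eps.
  pose proof (proj1 (filterlim_locally _ _) G eps) as L.
  revert L. apply filter_imp. intros x Hx.
  unfold ball in *. simpl in *. unfold AbsRing_ball, abs, minus, plus, opp in *. simpl in *.
  rewrite G0 in Hx. apply Rabs_def2 in Hx.
  pose proof (opnorm_perturb (M x) (M t)) as P1.
  pose proof (opnorm_perturb (M t) (M x)) as P2.
  rewrite entry_sum_minus_sym in P2. fold (g x) in P1, P2.
  apply Rabs_def1; lra.
Qed.

(** * Lyapunov exponents *)

Definition lognorm (a b : C) (n : nat) (rho t : R) : R :=
  ln (opnorm (cocycle_iter (matA a) b n (RtoC rho * cis (2 * PI * t))%C)).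

Lemma mcont_cocycle (a b : C) (n : nat) (rho t : R) :
  mcont (fun x => cocycle_iter (matA a) b n (RtoC rho * cis (2 * PI * x))%C) t.
Proof.
  induction n as [|n IH].
  - repeat split; apply continuous_const.
  - cbn [cocycle_iter]. apply mcont_mul; [|exact IH].
    split; [|split; [|split]]; try apply ccont_const.
    apply ccont_mult; [apply ccont_const|]. apply ccont_mult; [apply ccont_const|].
    apply ccont_cis.
Qed.

Lemma circle_neq_0 (rho t : R) : 0 < rho -> (RtoC rho * cis t)%C <> 0%C.
Proof.
  intros H. apply Cmod_gt_0. rewrite Cmod_mult, Cmod_cis, Cmod_R, Rabs_pos_eq; lra.
Qed.

Lemma opnorm_cocycle_pos (a b : C) (n : nat) (rho t : R) :
  Cmod b = 1 -> (forall j, (b ^ S j)%C <> 1%C) -> 0 < rho ->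
  0 < opnorm (cocycle_iter (matA a) b n (RtoC rho * cis (2 * PI * t))%C).
Proof.
  intros Hb Hirr Hrho. apply opnorm_pos, cocycle_matA_nonzero; auto.
  - apply Cmod_gt_0. lra.
  - apply circle_neq_0, Hrho.
Qed.

Lemma continuous_lognorm (a b : C) (n : nat) (rho t : R) :
  Cmod b = 1 -> (forall j, (b ^ S j)%C <> 1%C) -> 0 < rho ->
  continuous (lognorm a b n rho) t.
Proof.
  intros Hb Hirr Hrho.
  apply (continuous_comp
    (fun x => opnorm (cocycle_iter (matA a) b n (RtoC rho * cis (2 * PI * x))%C)) ln).
  - apply continuous_opnorm, mcont_cocycle.
  - apply continuous_ln, opnorm_cocycle_pos; assumption.
Qed.

Lemma det_cocycle (a b y : C) (n : nat) :
  mat2_det (cocycle_iter (matA a) b n y) = cprod (fun i => a - b ^ i * y)%C n.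
Proof.
  induction n as [|n IH].
  - unfold mat2_det. simpl. ring.
  - cbn [cocycle_iter cprod]. rewrite mat2_det_mul, IH, det_matA. ring.
Qed.

Lemma RInt_lognorm_ge (a b : C) (n : nat) (rho : R) :
  Cmod a = 1 -> Cmod b = 1 -> (forall j, (b ^ S j)%C <> 1%C) -> 0 < rho ->
  INR n * (Rmax 0 (ln rho) / 2) <= RInt (lognorm a b n rho) 0 1.
Proof.
  intros Ha Hb Hirr Hrho.
  (* Here [N = 2] because the determinant is bounded by the square of the norm. The products of
     moduli are [1] and [rho^n], giving the two lower bounds [0] and [n ln rho] for twice the
     integral. *)
  destruct (jensen_upper n (lognorm a b n rho) (fun _ => a) (fun i => b ^ i * RtoC rho)%C 2)
    as [J1 J2].
  - intros x. apply continuous_lognorm; assumption.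
  - lra.
  - intros s.
    rewrite (cprod_ext _ (fun i => a - b ^ i * (RtoC rho * cis (2 * PI * s)))%C)
      by (intros; ring).
    rewrite <- det_cocycle. eapply Rle_trans; [apply Cmod_det_le|].
    rewrite (double (lognorm a b n rho s)), exp_plus. unfold lognorm.
    rewrite exp_ln by (apply opnorm_cocycle_pos; assumption). right. ring.
  - rewrite (Cmod_cprod_const _ 1), pow1 in J1 by auto.
    rewrite (Cmod_cprod_const _ rho) in J2.
    2:{ intros i. rewrite Cmod_mult, Cmod_pow_unit, Cmod_R, Rabs_pos_eq by (auto; lra). ring. }
    set (I := RInt (lognorm a b n rho) 0 1) in *.
    assert (K1 : 0 <= 2 * I).
    { apply Rnot_lt_le. intros Hlt. apply exp_increasing in Hlt. rewrite exp_0 in Hlt. lra. }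
    assert (K2 : INR n * ln rho <= 2 * I).
    { apply Rnot_lt_le. intros Hlt. apply exp_increasing in Hlt.
      rewrite (Rmult_comm (INR n)), exp_mult_nat, exp_ln in Hlt by assumption. lra. }
    unfold Rmax. destruct (Rle_dec 0 (ln rho)); lra.
Qed.

Lemma RInt_lognorm_le (a b : C) (rho eta : R) :
  Cmod a = 1 -> Cmod b = 1 -> (forall j, (b ^ S j)%C <> 1%C) -> 0 < rho -> 0 < eta ->
  exists M, forall n,
    RInt (lognorm a b n rho) 0 1 <= M + INR n * (Rmax 0 (ln rho) / 2 + eta).
Proof.
  intros Ha Hb Hirr Hrho Heta.
  (* [Y] is the larger of [1] and the square root of [rho], the least value allowed by [1 <= Y] and
     [rho <= Y^2]. *)
  set (L := Rmax 0 (ln rho) / 2). set (Y := exp L).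
  assert (HL : 0 <= L) by (unfold L; pose proof (Rmax_l 0 (ln rho)); lra).
  assert (HY : 1 <= Y) by (unfold Y; pose proof (exp_ineq1_le L); lra).
  assert (HY2 : rho <= Y ^ 2).
  { unfold Y. rewrite <- exp_mult_nat. simpl INR.
    replace (L * (1 + 1)) with (Rmax 0 (ln rho)) by (unfold L; field).
    rewrite <- (exp_ln rho) at 1 by assumption.
    destruct (Rle_lt_or_eq_dec _ _ (Rmax_r 0 (ln rho))) as [H|H].
    - left. apply exp_increasing, H.
    - rewrite <- H. lra. }
  destruct (cocycle_matA_growth a b eta Y Ha Hb Hirr Heta HY) as [M [HM HG]].
  exists (ln M). intros n.
  replace (ln M + INR n * (L + eta)) with (RInt (fun _ => ln M + INR n * (L + eta)) 0 1).
  2:{ rewrite RInt_const. unfold scal. simpl. unfold mult. simpl. ring. }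
  apply RInt_le; [lra| |apply ex_RInt_const|].
  - apply ex_RInt_cont. intros x. apply continuous_lognorm; assumption.
  - intros t _. unfold lognorm.
    specialize (HG (RtoC rho * cis (2 * PI * t))%C n).
    rewrite Cmod_mult, Cmod_cis, Cmod_R, Rabs_pos_eq, Rmult_1_r in HG by lra.
    specialize (HG HY2).
    replace (ln M + INR n * (L + eta)) with (ln (M * exp (eta * INR n) * Y ^ n)).
    + apply ln_le; [apply opnorm_cocycle_pos; assumption|exact HG].
    + unfold Y. rewrite <- exp_mult_nat, !ln_mult, !ln_exp.
      * ring.
      * exact HM.
      * apply exp_pos.
      * apply Rmult_lt_0_compat; [exact HM|apply exp_pos].
      * apply exp_pos.
Qed.

Lemma lyapunov_matA (a b : C) (rho : R) :
  Cmod a = 1 -> Cmod b = 1 -> (forall j, (b ^ S j)%C <> 1%C) -> 0 < rho ->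
  lyapunov_is (matA a) b rho (Rmax 0 (ln rho) / 2).
Proof.
  intros Ha Hb Hirr Hrho. unfold lyapunov_is. apply is_lim_seq_Reals.
  intros eps Heps.
  destruct (RInt_lognorm_le a b rho (eps / 2)) as [M HM]; auto; [lra|].
  (* Beyond this threshold [|M| / n < eps / 2]; taking [S N] also keeps [n] positive. *)
  destruct (INR_unbounded (2 * Rabs M / eps)) as [N HN].
  exists (S N). intros n Hn.
  pose proof (RInt_lognorm_ge a b n rho Ha Hb Hirr Hrho) as Lo. specialize (HM n).
  unfold lyap_term.
  change (fun t => ln (opnorm (cocycle_iter (matA a) b n (RtoC rho * cis (2 * PI * t))%C)))
    with (lognorm a b n rho).
  set (I := RInt (lognorm a b n rho) 0 1) in *. set (L := Rmax 0 (ln rho) / 2) in *.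
  assert (Hn0 : 0 < INR n) by (apply lt_0_INR; lia).
  assert (HNn : INR N < INR n) by (apply lt_INR; lia).
  assert (HMn : Rabs M < eps / 2 * INR n).
  { assert (2 * Rabs M / eps < INR n) by lra.
    apply Rmult_lt_compat_r with (r := eps / 2) in H; [|lra].
    replace (2 * Rabs M / eps * (eps / 2)) with (Rabs M) in H by (field; lra). lra. }
  pose proof (Rle_abs M).
  (* The lower bound holds for each [n] without error term, so the difference is nonnegative and
     only the upper estimate needs [eps]. *)
  unfold R_dist. rewrite Rabs_pos_eq.
  - apply Rmult_lt_reg_l with (INR n); [exact Hn0|].
    replace (INR n * (/ INR n * I - L)) with (I - INR n * L) by (field; lra). lra.
  - apply Rmult_le_reg_l with (INR n); [exact Hn0|].
    replace (INR n * (/ INR n * I - L)) with (I - INR n * L) by (field; lra). lra.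
Qed.

(** * Reduction of the cocycle of [matB] to that of [matA] *)

Lemma cocycle_matB (a g y : C) (n : nat) :
  cocycle_iter (matB a) g n y = cocycle_iter (matA a) (g * g)%C n (y * y)%C.
Proof.
  induction n as [|n IH]; [reflexivity|]. cbn [cocycle_iter]. rewrite IH. f_equal.
  unfold matB, matA. f_equal. rewrite Cpow_mult_l. ring.
Qed.

(** Squaring sends the circle of radius [rho] twice around that of radius [rho^2], and doubling the
    angle preserves Haar measure. *)
Lemma lyap_term_matB (a g : C) (rho : R) (n : nat) :
  Cmod (g * g)%C = 1 -> (forall j, ((g * g) ^ S j)%C <> 1%C) -> 0 < rho ->
  lyap_term (matB a) g rho n = lyap_term (matA a) (g * g)%C (rho * rho) n.
Proof.
  intros Hg Hirr Hrho. unfold lyap_term. f_equal.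
  change (RInt (fun t => ln (opnorm (cocycle_iter (matA a) (g * g) n
    (RtoC (rho * rho) * cis (2 * PI * t))%C))) 0 1)
    with (RInt (lognorm a (g * g) n (rho * rho)) 0 1).
  set (F := lognorm a (g * g) n (rho * rho)).
  assert (HF : forall x, continuous F x).
  { intros x. apply continuous_lognorm; auto. apply Rmult_lt_0_compat; lra. }
  transitivity (RInt (fun t => F (2 * t + 0)) 0 1).
  - apply RInt_ext. intros t _. unfold F, lognorm. rewrite cocycle_matB.
    f_equal. f_equal. f_equal. rewrite RtoC_mult.
    replace (2 * PI * (2 * t + 0)) with (2 * PI * t + 2 * PI * t) by ring.
    rewrite cis_plus. ring.
  (* Since [F] has period one, averaging [t -> F (2 t)] over the two halves of the circle gives back
     [F]. *)
  - rewrite <- RInt_halve by (apply continuous_affine, HF).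
    apply RInt_ext. intros t _. unfold halve.
    replace (2 * (t / 2) + 0) with t by field.
    replace (F (2 * (t / 2 + 1 / 2) + 0)) with (F t).
    + simpl. field.
    + unfold F, lognorm. do 4 f_equal.
      rewrite <- (cis_period (2 * PI * t)). f_equal. field.
Qed.

Theorem theoremA :
  forall (alpha : C) (theta : R),
    Cmod alpha = 1 -> irrational theta ->
    let beta := cis (2 * PI * theta) in
    (forall rho : R, 1 < rho ->
       exists L : R, 0 < L /\ lyapunov_is (matA alpha) beta rho L) /\
    (forall rho : R, 0 < rho -> rho <= 1 ->
       lyapunov_is (matA alpha) beta rho 0) /\
    (forall (gam : C), (gam * gam)%C = beta ->
       (forall x y : C, (x + 1)%C <> 0%C ->
          f_ab alpha beta (semi (x, y)) = semi (g_map alpha gam (x, y))) /\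
       (forall rho : R, 0 < rho ->
          lyapunov_is (matB alpha) gam rho (Rmax 0 (ln rho)))).
Proof.
  intros alpha theta Ha Hth beta.
  assert (Hb : Cmod beta = 1) by apply Cmod_cis.
  assert (Hirr : forall j, (beta ^ S j)%C <> 1%C)
    by (intros j; apply cis_irrational, Hth).
  split; [|split].
  - intros rho Hrho. exists (Rmax 0 (ln rho) / 2). split.
    + assert (0 < ln rho) by (rewrite <- ln_1; apply ln_increasing; lra).
      pose proof (Rmax_r 0 (ln rho)). lra.
    + apply lyapunov_matA; auto. lra.
  - intros rho H0 H1.
    replace 0 with (Rmax 0 (ln rho) / 2) at 1; [apply lyapunov_matA; auto|].
    rewrite Rmax_left; [lra|]. rewrite <- ln_1. apply ln_le; lra.
  - intros gam Hgam. split.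
    + intros x y _. unfold f_ab, semi, g_map. simpl fst. simpl snd. f_equal.
      rewrite <- Hgam. ring.
    + intros rho Hrho. unfold lyapunov_is.
      apply is_lim_seq_ext with (lyap_term (matA alpha) beta (rho * rho)).
      * intros n. rewrite <- Hgam. symmetry.
        apply lyap_term_matB; rewrite ?Hgam; auto.
      (* The radius [rho^2] doubles the logarithm, which cancels the factor one half in the exponent
         of [matA]. *)
      * replace (Rmax 0 (ln rho)) with (Rmax 0 (ln (rho * rho)) / 2).
        -- apply lyapunov_matA; auto. apply Rmult_lt_0_compat; lra.
        -- rewrite ln_mult by lra. unfold Rmax.
           destruct (Rle_dec 0 (ln rho + ln rho)), (Rle_dec 0 (ln rho)); lra.
Qed.
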